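(* Let $z\in[0,1)$. The following are equivalent: (i) $z$ is computably random. (ii) Every computable nondecreasing function $f\colon[0,1]\to\mathbb{R}$ is differentiable at $z$. (iii) Every computable nondecreasing function $g\colon[0,1]\to\mathbb{R}$ satisfies $\overline{D}g(z)<\infty$. (iv) Every computable nondecreasing function $g\colon[0,1]\to\mathbb{R}$ satisfies $\underline{D}g(z)<\infty$.
   Context: A Cauchy name for a real $x$ is a sequence of rationals $(q_n)_{n\in\mathbb N}$ with $|q_n-q_{n-1}|\le 2^{-n}$ for all $n>0$ and $\lim_n q_n=x$. A real is computable if it has a computable Cauchy name; a sequence of reals $(x_n)$ is computable if there is a computable double sequence of rationals $(q_{n,k})$ such that $(q_{n,k})_k$ is a Cauchy name for $x_n$ for each $n$. A function $f\colon[0,1]\to\mathbb R$ is computable if (a) for every computable sequence of reals $(x_k)$ in $[0,1]$ the sequence $(f(x_k))$ is computable, and (b) there is a computable $h\colon\mathbb N\to\mathbb N$ such that $|x-y|<2^{-h(n)}$ implies $|f(x)-f(y)|<2^{-n}$ for all $n$. A martingale is a function $M\colon\{0,1\}^{<\omega}\to[0,\infty)$ with $M(\sigma0)+M(\sigma1)=2M(\sigma)$ for every string $\sigma$; it is computable if $M(\sigma)$ is a computable real uniformly in $\sigma$; it succeeds on an infinite bit sequence $Z$ if $\{M(Z\upharpoonright n):n\in\mathbb N\}$ is unbounded. A bit sequence is computably random if no computable martingale succeeds on it; a real $z\in[0,1)$ is computably random if its binary expansion (the one with infinitely many 0s) is computably random. For a function $f$, $S_f(a,b)=\frac{f(a)-f(b)}{a-b}$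 for distinct $a,b$ in its domain; $\overline Df(z)=\limsup_{h\to0}S_f(z,z+h)$ and $\underline Df(z)=\liminf_{h\to0}S_f(z,z+h)$, with values $\pm\infty$ allowed (here $z+h$ ranges over the domain). $f$ is differentiable at $z$ iff $\underline Df(z)=\overline Df(z)$ and this value is finite. *)

(* Defs.v *)
From HB Require Import structures.
From mathcomp Require Import all_boot all_order all_algebra.
From mathcomp Require Import all_classical all_reals all_analysis.

Set Implicit Arguments.
Unset Strict Implicit.
Unset Printing Implicit Defensive.

Import Order.TTheory GRing.Theory Num.Theory.
Import numFieldNormedType.Exports.

Local Open Scope classical_set_scope.
Local Open Scope ring_scope.

(* Kleene's partial recursive functions: [rec_code k] is the type of
   definitions of k-ary partial recursive functions. *)
Inductive rec_code : nat -> Type :=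
| rc_zero n : rec_code n
| rc_succ : rec_code 1
| rc_proj n (i : 'I_n) : rec_code n
| rc_comp m n (f : rec_code m) (g : 'I_m -> rec_code n) : rec_code n
| rc_prec n (f : rec_code n) (g : rec_code n.+2) : rec_code n.+1
| rc_mu n (f : rec_code n.+1) : rec_code n.

(* [rec_eval c v y]: the computation of c on the inputs v halts with value y.
   Recursion and minimization act on the first argument; for recursion, [s k]
   is the value at the stage k of the recursion. *)
Fixpoint rec_eval n (c : rec_code n) : n.-tuple nat -> nat -> Prop :=
  match c in rec_code n return n.-tuple nat -> nat -> Prop with
  | rc_zero _ => fun _ y => y = 0%N
  | rc_succ => fun v y => y = (tnth v ord0).+1
  | rc_proj _ i => fun v y => y = tnth v i
  | rc_comp m _ f g => fun v y =>
      exists w : m.-tuple nat,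
        (forall i, rec_eval (g i) v (tnth w i)) /\ rec_eval f w y
  | rc_prec _ f g => fun v y =>
      exists s : nat -> nat,
        [/\ rec_eval f [tuple of behead v] (s 0%N),
            forall k, (k < thead v)%N ->
              rec_eval g [tuple of k :: s k :: behead v] (s k.+1)
          & y = s (thead v)]
  | rc_mu _ f => fun v y =>
      rec_eval f [tuple of y :: v] 0%N /\
      forall k, (k < y)%N -> exists r : nat, rec_eval f [tuple of k :: v] r.+1
  end.

Definition computable1 (h : nat -> nat) : Prop :=
  exists c : rec_code 1, forall n, rec_eval c [tuple n] (h n).

Definition computable2 (h : nat -> nat -> nat) : Prop :=
  exists c : rec_code 2, forall n k, rec_eval c [tuple n; k] (h n k).

Definition computable_rat_dseq (q : nat -> nat -> rat) : Prop :=
  exists a b d : nat -> nat -> nat,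
    [/\ computable2 a, computable2 b, computable2 d
      & forall n k, q n k = ((a n k)%:R - (b n k)%:R) / (d n k).+1%:R].

Definition cauchy_name (R : realType) (q : nat -> rat) (x : R) : Prop :=
  (forall n, (0 < n)%N -> `|q n - q n.-1| <= 2 ^- n) /\
  (fun n => ratr (q n) : R) @ \oo --> x.

Definition computable_real_seq (R : realType) (x : nat -> R) : Prop :=
  exists q : nat -> nat -> rat,
    computable_rat_dseq q /\ forall n, cauchy_name (q n) (x n).

(* A function on [0,1] is represented by a total function on R; here and below,
   only its values on [0,1] matter. *)
Definition computable_fun01 (R : realType) (f : R -> R) : Prop :=
  (forall x : nat -> R, (forall k, 0 <= x k <= 1) ->
     computable_real_seq x -> computable_real_seq (fun k => f (x k))) /\
  (exists h : nat -> nat, computable1 h /\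
     forall (n : nat) (x y : R), 0 <= x <= 1 -> 0 <= y <= 1 ->
       `|x - y| < 2 ^- h n -> `|f x - f y| < 2 ^- n).

Definition nondecreasing01 (R : realType) (f : R -> R) : Prop :=
  {in `[0, 1] &, {homo f : x y / x <= y}}.

(* The string s is coded by the number whose binary notation is 1s. *)
Definition string_code (s : seq bool) : nat :=
  foldl (fun (n : nat) (b : bool) => n.*2 + b)%N 1%N s.

Definition martingale (R : realType) (M : seq bool -> R) : Prop :=
  (forall s, 0 <= M s) /\
  (forall s, M (rcons s false) + M (rcons s true) = 2 * M s).

Definition computable_on_strings (R : realType) (M : seq bool -> R) : Prop :=
  exists q : nat -> nat -> rat,
    computable_rat_dseq q /\ forall s, cauchy_name (q (string_code s)) (M s).

Definition succeeds_on (R : realType) (M : seq bool -> R) (Z : nat -> bool) :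
    Prop :=
  ~ has_ubound (range (fun n : nat => M (mkseq Z n))).

Definition computably_random_seq (R : realType) (Z : nat -> bool) : Prop :=
  forall M : seq bool -> R,
    martingale M -> computable_on_strings M -> ~ succeeds_on M Z.

Definition binary_expansion (R : realType) (Z : nat -> bool) (z : R) : Prop :=
  series (fun i : nat => (Z i)%:R / 2 ^+ i.+1 : R) @ \oo --> z /\
  (forall n : nat, exists2 m : nat, (n <= m)%N & Z m = false).

(* The expansion Z is unique, and it exists for z in [0,1). *)
Definition computably_random (R : realType) (z : R) : Prop :=
  exists2 Z : nat -> bool, binary_expansion Z z & computably_random_seq R Z.

Definition slope (R : realType) (f : R -> R) (a b : R) : R :=
  (f a - f b) / (a - b).

(* The filter of h -> 0, with h <> 0 and z + h in [0,1]. *)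
Definition increments01 (R : realType) (z : R) : set_system R :=
  within [set h : R | 0 <= z + h <= 1] (0 : R)^'.

Definition upper_derivative (R : realType) (f : R -> R) (z : R) : \bar R :=
  limf_esup (fun h => (slope f z (z + h))%:E) (increments01 z).

Definition lower_derivative (R : realType) (f : R -> R) (z : R) : \bar R :=
  limf_einf (fun h => (slope f z (z + h))%:E) (increments01 z).

Definition differentiable01 (R : realType) (f : R -> R) (z : R) : Prop :=
  lower_derivative f z = upper_derivative f z /\
  upper_derivative f z \is a fin_num.

(* Main.v *)
(* The proof reworks F. Riesz's rising-sun proof of Lebesgue's theorem so that every
   step is computable.

   For 0 < a < 1 and nondecreasing f, let
     L g x = inf_{y <= x} (g y + f x - f y),   U g x = sup_{y >= x} (g y - (y - x)).
   If g has slope a around z and f has, arbitrarily close to z, chords [y, z] of slope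
   < a, then L g = f + constant around z; if moreover f has, arbitrarily close to z,
   chords [z, y] of slope > 1, then U (L g) has slope 1 around z.  Iterating
   G 0 = id, G (k + 1) = U (L (a G k)) gives nondecreasing 1-Lipschitz functions with
   G k <= a^k and slope 1 around z.  Weighting a subsequence with the factors 2^k and
   summing produces a nondecreasing function with derivative +oo at z.  The envelopes
   are computable without any decision on reals: by monotonicity, the extremum over a
   dyadic grid is uniformly close to the true one.  After scaling and reflecting f,
   this covers every f whose slopes at z oscillate; when the slopes of f at z are
   unbounded, the functions U (4^-k f) and their mirror images serve instead of the
   G k.  The latter also applies to the distribution function of a computable
   martingale, possibly discontinuous, that succeeds on z.

   Conversely, the slopes over dyadic intervals of a computable nondecreasing function
   with derivative +oo at z form a computable martingale that succeeds on z. *)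

Require Import Defs.
From mathcomp Require Import all_boot all_order all_algebra.
From mathcomp Require Import all_classical all_reals all_analysis.
From mathcomp Require Import zify ring lra.

Set Implicit Arguments.
Unset Strict Implicit.
Unset Printing Implicit Defensive.

Import Order.TTheory GRing.Theory Num.Theory.
Import numFieldNormedType.Exports.

Local Open Scope nat_scope.

(** Both nontrivial implications rest on one notion: a failure of (i) or of (ii) at z is turned into
    a [steep_family] at z. Its weighted sum g is computable, nondecreasing and has derivative +oo at
    z; g refutes (iv) directly and refutes (i) through its dyadic slopes.

    The working notion of computability is [dyadic_computable]: approximate values at dyadic points,
    with no modulus of continuity. Envelopes preserve it, and it is all that a discontinuous
    distribution function can offer. A computable modulus has to be produced only for the final sum,
    where it comes from the Lipschitz bounds of the terms.

    The envelope argument wants small slopes on one side of z and large slopes on the other. If both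
    occur on the same side, comparing the slopes on the other side with an intermediate constant
    supplies the missing partner.

    Dyadic z are treated apart: there z ends up as an endpoint of the intervals of its own
    expansion, so that these give no chords around z, but a step function that jumps at z is
    computable on dyadic points. *)

(** * Closure properties of total recursive functions *)

Definition tuple_computable n (F : n.-tuple nat -> nat) :=
  exists c : rec_code n, forall v, rec_eval c v (F v).

Lemma tuple_computable_comp m n (F : m.-tuple nat -> nat)
    (G : 'I_m -> n.-tuple nat -> nat) :
  tuple_computable F -> (forall i, tuple_computable (G i)) ->
  tuple_computable (fun v => F [tuple G i v | i < m]).
Proof.
move=> [c cF] /choice[d dG]; exists (rc_comp c d) => v /=.
exists [tuple G i v | i < m]; split=> // i; rewrite tnth_mktuple.
exact: dG.
Qed.

Lemma tuple_computable_proj n (i : 'I_n) :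
  tuple_computable (fun v => tnth v i).
Proof. by exists (rc_proj i). Qed.

Lemma tuple_computable_app1 n (f : nat -> nat) (G : n.-tuple nat -> nat) :
  computable1 f -> tuple_computable G -> tuple_computable (fun v => f (G v)).
Proof.
move=> [c cf] [d dG]; exists (rc_comp c (fun=> d)) => v /=.
by exists [tuple G v]; split=> [i|//]; rewrite (ord1 i).
Qed.

Lemma tuple_computable_app2 n (f : nat -> nat -> nat)
    (G H : n.-tuple nat -> nat) :
  computable2 f -> tuple_computable G -> tuple_computable H ->
  tuple_computable (fun v => f (G v) (H v)).
Proof.
move=> [c cf] [d dG] [e eH].
exists (rc_comp c (fun i => if i == ord0 then d else e)) => v /=.
by exists [tuple G v; H v]; split=> // -[[|[|//]] ?].
Qed.

Lemma tuple_computable_rec n (f : n.-tuple nat -> nat)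
    (g : nat -> nat -> n.-tuple nat -> nat) (h : n.-tuple nat -> nat) :
  tuple_computable f ->
  tuple_computable (fun w : n.+2.-tuple nat =>
    g (thead w) (thead [tuple of behead w]) [tuple of behead (behead w)]) ->
  tuple_computable h ->
  tuple_computable
    (fun v => nat_rect (fun=> nat) (f v) (fun k s => g k s v) (h v)).
Proof.
move=> [cf Hf] [cg Hg] [ch Hh].
(* [rc_prec] recurses on its first argument, so [d] puts the number of rounds [h v] in front of
   [v]. *)
pose d (i : 'I_n.+1) := if unlift ord0 i is Some j then rc_proj j else ch.
exists (rc_comp (rc_prec cf cg) d) => v /=.
exists [tuple of h v :: v]; split=> [i|].
  rewrite /d; case: unliftP => [j ->|->]; last by rewrite tnth0.
  by rewrite tnthS.
exists (fun k => nat_rect (fun=> nat) (f v) (fun k s => g k s v) k).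
have E : [tuple of behead [tuple of h v :: v]] = v by apply/val_inj.
split; rewrite ?theadE ?E //= => k _.
have := Hg [tuple of k :: nat_rect (fun=> nat) (f v) (fun k s => g k s v) k
  :: behead [tuple of h v :: v]].
rewrite theadE; congr (rec_eval _ _ _).
by congr g; apply/val_inj.
Qed.

Lemma computable1E f :
  computable1 f <-> tuple_computable (fun v : 1.-tuple nat => f (thead v)).
Proof.
split=> [cf|[c cf]]; last by exists c => n; apply: (cf [tuple n]).
exact: tuple_computable_app1 cf (tuple_computable_proj ord0).
Qed.

Lemma computable2E f : computable2 f <->
  tuple_computable (fun v : 2.-tuple nat => f (thead v) (tnth v (lift ord0 ord0))).
Proof.
split=> [cf|[c cf]]; last by exists c => n k; apply: (cf [tuple n; k]).
exact: tuple_computable_app2 cf (tuple_computable_proj _) (tuple_computable_proj _).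
Qed.

Lemma tuple_computable_cst n (m : nat) :
  tuple_computable (fun _ : n.-tuple nat => m).
Proof.
elim: m => [|m IH]; first by exists (rc_zero n).
by apply: (@tuple_computable_app1 _ succn) => //; exists rc_succ.
Qed.

Lemma computable1_succ : computable1 succn.
Proof. by exists rc_succ. Qed.

Lemma computable2_rec (f : nat -> nat) (g : nat -> nat -> nat -> nat) :
  computable1 f ->
  tuple_computable (fun w : 3.-tuple nat =>
    g (thead w) (tnth w (inord 1)) (tnth w (inord 2))) ->
  computable2 (fun x n => nat_rect (fun=> nat) (f x) (fun k s => g k s x) n).
Proof.
move=> cf cg; apply/computable2E.
apply: (@tuple_computable_rec 2 (fun v => f (thead v))
  (fun k s v => g k s (thead v)) (fun v => tnth v (lift ord0 ord0))).
- exact: tuple_computable_app1 cf (tuple_computable_proj ord0).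
(* The step receives [k, s, x, n]; the number of rounds n, still present as a parameter, is
   dropped. *)
- have := @tuple_computable_comp 3 4 _
    (fun i w => tnth w (widen_ord (leqnSn 3) i)) cg
    (fun i => tuple_computable_proj _).
  congr tuple_computable; apply/funext => w.
  rewrite /thead !tnth_mktuple !(tnth_nth 0) /= !nth_behead !inordK //.
- exact: tuple_computable_proj.
Qed.

Lemma computable2_diag (f : nat -> nat -> nat) :
  computable2 f -> computable1 (fun x => f x x).
Proof.
move=> cf; apply/computable1E.
by apply: tuple_computable_app2 cf _ _; apply: tuple_computable_proj.
Qed.

Lemma computable1_id : computable1 id.
Proof. by apply/computable1E; apply: tuple_computable_proj. Qed.

Lemma computable1_cst m : computable1 (fun=> m).
Proof. by apply/computable1E; apply: tuple_computable_cst. Qed.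

Lemma computable1_comp f g :
  computable1 f -> computable1 g -> computable1 (fun x => f (g x)).
Proof.
move=> cf /computable1E cg; apply/computable1E.
exact: (tuple_computable_app1 cf).
Qed.

Lemma computable1_app2 f g h : computable2 f -> computable1 g ->
  computable1 h -> computable1 (fun x => f (g x) (h x)).
Proof.
move=> cf /computable1E cg /computable1E ch; apply/computable1E.
exact: (tuple_computable_app2 cf).
Qed.

Lemma computable2_app2 f g h : computable2 f -> computable2 g ->
  computable2 h -> computable2 (fun x y => f (g x y) (h x y)).
Proof.
move=> cf /computable2E cg /computable2E ch; apply/computable2E.
exact: (tuple_computable_app2 cf).
Qed.

Lemma computable2_app1 f g : computable1 f -> computable2 g ->
  computable2 (fun x y => f (g x y)).
Proof.
move=> cf /computable2E cg; apply/computable2E.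
exact: (tuple_computable_app1 cf).
Qed.

Lemma computable2_add : computable2 addn.
Proof.
have -> : addn = fun x n => nat_rect (fun=> nat) x (fun _ s => s.+1) n.
  apply/funext => x; apply/funext; elim=> [|n IH] /=; first by rewrite addn0.
  by rewrite addnS IH.
apply: (@computable2_rec id (fun _ s _ => s.+1)); first exact: computable1_id.
apply: tuple_computable_app1 computable1_succ _; exact: tuple_computable_proj.
Qed.

Lemma computable1_pred : computable1 predn.
Proof.
have -> : predn = fun n => nat_rect (fun=> nat) 0 (fun k _ => k) n.
  by apply/funext; case.
apply: (@computable2_diag (fun x n => nat_rect (fun=> nat) 0 (fun k _ => k) n)).
apply: (@computable2_rec (fun=> 0) (fun k _ _ => k)).
  exact: computable1_cst.
exact: tuple_computable_proj.
Qed.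

Lemma computable2_sub : computable2 subn.
Proof.
have -> : subn = fun x n => nat_rect (fun=> nat) x (fun _ s => s.-1) n.
  apply/funext => x; apply/funext; elim=> [|n IH] /=; first by rewrite subn0.
  by rewrite subnS IH.
apply: (@computable2_rec id (fun _ s _ => s.-1)); first exact: computable1_id.
apply: tuple_computable_app1 computable1_pred _; exact: tuple_computable_proj.
Qed.

Lemma computable2_mul : computable2 muln.
Proof.
have -> : muln = fun x n => nat_rect (fun=> nat) 0 (fun _ s => s + x) n.
  apply/funext => x; apply/funext; elim=> [|n IH] /=; first by rewrite muln0.
  by rewrite mulnSr IH.
apply: (@computable2_rec (fun=> 0) (fun _ s x => s + x)).
  exact: computable1_cst.
by apply: tuple_computable_app2 computable2_add _ _; apply: tuple_computable_proj.
Qed.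

Lemma computable2_exp : computable2 expn.
Proof.
have -> : expn = fun x n => nat_rect (fun=> nat) 1 (fun _ s => s * x) n.
  apply/funext => x; apply/funext; elim=> [|n IH] //=.
  by rewrite expnSr IH.
apply: (@computable2_rec (fun=> 1) (fun _ s x => s * x)).
  exact: computable1_cst.
by apply: tuple_computable_app2 computable2_mul _ _; apply: tuple_computable_proj.
Qed.

Lemma computable2_leq : computable2 (fun m n => (m <= n : nat)).
Proof.
have -> : (fun m n => (m <= n : nat)) = fun m n => 1 - (m - n).
  by apply/funext => m; apply/funext => n; case: leqP; lia.
apply: computable2_app2 computable2_sub _ computable2_sub.
apply/computable2E; exact: tuple_computable_cst.
Qed.

(** * Computable functions between coded types *)

(* The sum of the components is the integer square root of the code. *)
Definition npair a b := (a + b) ^ 2 + a.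
Definition nroot p := nat_rect (fun=> nat) 0 (fun k s => s + (k.+1 ^ 2 <= p)) p.
Definition nfst p := p - nroot p ^ 2.
Definition nsnd p := nroot p - nfst p.

Lemma nrootE a b : nroot (npair a b) = a + b.
Proof.
(* The loop counts the positive k <= n whose square is at most p; n = p rounds are enough since s <=
   p. *)
have H p s n : s ^ 2 <= p < s.+1 ^ 2 ->
    nat_rect (fun=> nat) 0 (fun k s => s + (k.+1 ^ 2 <= p)) n = minn n s.
  move=> /andP[sp ps]; elim: n => [|n IH]; first by rewrite min0n.
  rewrite [LHS]/= [X in X + _]IH.
  have [le|lt] := leqP (n.+1 ^ 2) p; have [ns|sn] := leqP n.+1 s.
  - by rewrite addn1 !(minn_idPl _) // ltnW.
  - by have := leq_ltn_trans le ps; rewrite ltn_sqr ltnS leqNgt sn.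
  - by have := leq_ltn_trans sp lt; rewrite ltn_sqr ltnNge ns.
  - by rewrite addn0 !(minn_idPr _) // ltnW.
rewrite /nroot (H _ (a + b)); first by apply/minn_idPr; rewrite /npair; nia.
by rewrite /npair !expnS !expn0; nia.
Qed.

Lemma npairK1 a b : nfst (npair a b) = a.
Proof. by rewrite /nfst nrootE /npair addKn. Qed.

Lemma npairK2 a b : nsnd (npair a b) = b.
Proof. by rewrite /nsnd npairK1 nrootE addKn. Qed.

Lemma computable1_root : computable1 nroot.
Proof.
apply: (@computable2_diag (fun p n =>
  nat_rect (fun=> nat) 0 (fun k s => s + (k.+1 ^ 2 <= p)) n)).
apply: (@computable2_rec (fun=> 0) (fun k s p => s + (k.+1 ^ 2 <= p))).
  exact: computable1_cst.
apply: tuple_computable_app2 computable2_add (tuple_computable_proj _) _.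
apply: tuple_computable_app2 computable2_leq _ (tuple_computable_proj _).
apply: tuple_computable_app2 computable2_exp _ (tuple_computable_cst _ _).
apply: tuple_computable_app1 computable1_succ (tuple_computable_proj _).
Qed.

Lemma computable2_npair : computable2 npair.
Proof.
have c1 : computable2 (fun a _ => a).
  by apply/computable2E; apply: tuple_computable_proj.
apply: computable2_app2 computable2_add _ c1.
apply: computable2_app2 computable2_exp computable2_add _.
apply/computable2E; exact: tuple_computable_cst.
Qed.

Lemma computable1_nfst : computable1 nfst.
Proof.
apply: computable1_app2 computable2_sub computable1_id _.
exact: computable1_app2 computable2_exp computable1_root (computable1_cst _).
Qed.

Lemma computable1_nsnd : computable1 nsnd.
Proof. exact: computable1_app2 computable2_sub computable1_root computable1_nfst. Qed.

Class encoding (T : Type) := encode : T -> nat.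

#[export] Instance encoding_nat : encoding nat := id.
#[export] Instance encoding_bool : encoding bool := nat_of_bool.
#[export] Instance encoding_prod (T U : Type) (eT : encoding T) (eU : encoding U) :
  encoding (T * U) := fun p => npair (encode p.1) (encode p.2).
#[export] Instance encoding_seq (T : Type) (eT : encoding T) : encoding (seq T) :=
  foldr (fun x c => (npair (encode x) c).+1) 0.

(** The recursive function is constrained on codes of elements only; its values elsewhere are
    arbitrary. *)
Definition computable (T U : Type) {eT : encoding T} {eU : encoding U} (f : T -> U) :=
  exists2 F : nat -> nat, computable1 F & forall t, F (encode t) = encode (f t).

Lemma comp_computable1 f : computable f <-> computable1 f.
Proof.
split=> [[F cF FE]|cf]; last by exists f.
by have -> : f = F by apply/funext => t; rewrite -[f t]FE.
Qed.

Lemma comp_computable2 (f : nat * nat -> nat) :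
  computable f <-> computable2 (fun x y => f (x, y)).
Proof.
split=> [[F cF FE]|cf].
  have -> : (fun x y => f (x, y)) = fun x y => F (npair x y).
    by apply/funext => x; apply/funext => y; rewrite -[f _]FE.
  exact: computable2_app1 cF computable2_npair.
exists (fun p => f (nfst p, nsnd p)).
  exact: computable1_app2 cf computable1_nfst computable1_nsnd.
by case=> a b; rewrite /encode /encoding_prod npairK1 npairK2.
Qed.

Section comp_theory.
Context (T U V W : Type).
Context {eT : encoding T} {eU : encoding U} {eV : encoding V} {eW : encoding W}.

Lemma comp_id : computable (fun x : T => x).
Proof. by exists id => //; exact: computable1_id. Qed.

Lemma comp_cst (u : U) : computable (fun _ : T => u).
Proof. by exists (fun=> encode u) => //; exact: computable1_cst. Qed.

Lemma comp_comp (g : U -> V) (f : T -> U) :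
  computable g -> computable f -> computable (fun x => g (f x)).
Proof.
move=> [G cG GE] [F cF FE]; exists (fun x => G (F x)).
  exact: computable1_comp.
by move=> t; rewrite FE GE.
Qed.

Lemma comp_pair (f : T -> U) (g : T -> V) :
  computable f -> computable g -> computable (fun x => (f x, g x)).
Proof.
move=> [F cF FE] [G cG GE]; exists (fun x => npair (F x) (G x)).
  exact: computable1_app2 computable2_npair cF cG.
by move=> t; rewrite FE GE.
Qed.

Lemma comp_fst (f : T -> U * V) : computable f -> computable (fun x => (f x).1).
Proof.
move=> [F cF FE]; exists (fun x => nfst (F x)).
  exact: computable1_comp computable1_nfst cF.
by move=> t; rewrite FE; exact: npairK1.
Qed.

Lemma comp_snd (f : T -> U * V) : computable f -> computable (fun x => (f x).2).
Proof.
move=> [F cF FE]; exists (fun x => nsnd (F x)).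
  exact: computable1_comp computable1_nsnd cF.
by move=> t; rewrite FE; exact: npairK2.
Qed.

Lemma comp_rec (h : T -> nat) (f : T -> U) (g : T -> nat -> U -> U) :
  computable h -> computable f -> computable (fun p : T * nat * U => g p.1.1 p.1.2 p.2) ->
  computable (fun t => nat_rect (fun=> U) (f t) (g t) (h t)).
Proof.
move=> [H cH HE] [F cF FE] [G cG GE].
exists (fun x => nat_rect (fun=> nat) (F x)
    (fun k s => G (npair (npair x k) s)) (H x)).
  pose r x n := nat_rect (fun=> nat) (F x)
    (fun k s => G (npair (npair x k) s)) n.
  apply: (@computable1_app2 r id H) computable1_id cH.
  apply: (@computable2_rec F (fun k s x => G (npair (npair x k) s))) => //.
  apply: tuple_computable_app1 cG _.
  apply: tuple_computable_app2 computable2_npair _ (tuple_computable_proj _).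
  by apply: tuple_computable_app2 computable2_npair _ _; apply: tuple_computable_proj.
move=> t; rewrite HE; rewrite {1}/encode /encoding_nat.
elim: (h t) => [|n /= ->]; first exact: FE.
exact: (GE (t, n, _)).
Qed.

Lemma comp_if (b : T -> bool) (f g : T -> U) :
  computable b -> computable f -> computable g ->
  computable (fun x => if b x then f x else g x).
Proof.
move=> [B cB BE] [F cF FE] [G cG GE].
exists (fun x => B x * F x + (1 - B x) * G x); last first.
  move=> t; rewrite BE FE GE /encode /encoding_bool.
  by case: (b t); rewrite !(mul1n, mul0n, addn0).
apply: computable1_app2 computable2_add _ _.
  exact: computable1_app2 computable2_mul _ _.
apply: computable1_app2 computable2_mul _ cG.
exact: computable1_app2 computable2_sub (computable1_cst _) cB.
Qed.

Lemma comp_app2 (f : nat -> nat -> nat) (g h : T -> nat) : computable2 f ->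
  computable g -> computable h -> computable (fun x => f (g x) (h x)).
Proof.
move=> cf [G cG GE] [H cH HE]; exists (fun x => f (G x) (H x)).
  exact: computable1_app2.
by move=> t; rewrite GE HE.
Qed.

Lemma comp_leq (f g : T -> nat) : computable f -> computable g ->
  computable (fun x => f x <= g x).
Proof.
by move=> cf cg; have [F cF FE] := comp_app2 computable2_leq cf cg; exists F.
Qed.

Lemma comp_cons (f : T -> U) (g : T -> seq U) : computable f -> computable g ->
  computable (fun x => f x :: g x).
Proof.
move=> [F cF FE] [G cG GE]; exists (fun x => (npair (F x) (G x)).+1).
  apply: computable1_comp computable1_succ _.
  exact: computable1_app2 computable2_npair cF cG.
by move=> t; rewrite FE GE.
Qed.

Lemma comp_behead (f : T -> seq U) : computable f -> computable (fun x => behead (f x)).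
Proof.
(* The empty list has code 0, and [nsnd 0] is 0, so it needs no separate case. *)
move=> [F cF FE]; exists (fun x => nsnd (F x).-1).
  apply: computable1_comp computable1_nsnd _.
  exact: computable1_comp computable1_pred _.
move=> t; rewrite FE; case: (f t) => [|x s] /=; first by [].
exact: npairK2.
Qed.

Lemma comp_head (x0 : U) (f : T -> seq U) :
  computable f -> computable (fun x => head x0 (f x)).
Proof.
move=> [F cF FE].
exists (fun x => (F x <= 0) * encode x0 + (1 - (F x <= 0)) * nfst (F x).-1).
  have c0 : computable1 (fun x => (F x <= 0 : nat)).
    exact: (computable1_app2 computable2_leq cF (computable1_cst 0)).
  apply: computable1_app2 computable2_add _ _.
    exact: computable1_app2 computable2_mul c0 (computable1_cst _).
  apply: computable1_app2 computable2_mul _ _.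
    exact: computable1_app2 computable2_sub (computable1_cst _) c0.
  apply: computable1_comp computable1_nfst _.
  exact: computable1_comp computable1_pred _.
move=> t; rewrite FE; case: (f t) => [|x s] /=.
  by rewrite mul1n addn0.
by rewrite mul0n mul1n; exact: npairK1.
Qed.

End comp_theory.

Section comp_nat.
Context (T : Type) {eT : encoding T}.
Implicit Types f g : T -> nat.

Lemma comp_succ f : computable f -> computable (fun x => (f x).+1).
Proof. exact/comp_comp/comp_computable1/computable1_succ. Qed.

Lemma comp_pred f : computable f -> computable (fun x => (f x).-1).
Proof. exact/comp_comp/comp_computable1/computable1_pred. Qed.

Lemma comp_add f g : computable f -> computable g -> computable (fun x => f x + g x).
Proof. exact/comp_app2/computable2_add. Qed.

Lemma comp_sub f g : computable f -> computable g -> computable (fun x => f x - g x).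
Proof. exact/comp_app2/computable2_sub. Qed.

Lemma comp_mul f g : computable f -> computable g -> computable (fun x => f x * g x).
Proof. exact/comp_app2/computable2_mul. Qed.

Lemma comp_exp f g : computable f -> computable g -> computable (fun x => f x ^ g x).
Proof. exact/comp_app2/computable2_exp. Qed.

Lemma comp_nfst f : computable f -> computable (fun x => nfst (f x)).
Proof. exact/comp_comp/comp_computable1/computable1_nfst. Qed.

Lemma comp_nsnd f : computable f -> computable (fun x => nsnd (f x)).
Proof. exact/comp_comp/comp_computable1/computable1_nsnd. Qed.

End comp_nat.

(** Selects the closure rule from the head symbol of the body; an opaque function is looked up among
    the hypotheses [computable q]. Conditionals are the fallback. *)
Ltac comp_nat_step :=
  match goal with
  | |- computable (fun x => x) => exact: comp_id
  | |- computable fst => refine (@comp_fst _ _ _ _ _ _ (fun x => x) _)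
  | |- computable snd => refine (@comp_snd _ _ _ _ _ _ (fun x => x) _)
  | |- computable (fun _ => ?u) => exact: comp_cst
  | |- computable (fun x => (@?f x, @?g x)) => apply: (@comp_pair _ _ _ _ _ _ f g)
  | |- computable (fun x => (@?f x).1) => apply: (@comp_fst _ _ _ _ _ _ f)
  | |- computable (fun x => (@?f x).2) => apply: (@comp_snd _ _ _ _ _ _ f)
  | |- computable (fun x => (@?f x).+1) => apply: (@comp_succ _ _ f)
  | |- computable (fun x => (@?f x).-1) => apply: (@comp_pred _ _ f)
  | |- computable (fun x => @?f x + @?g x) => apply: (@comp_add _ _ f g)
  | |- computable (fun x => @?f x - @?g x) => apply: (@comp_sub _ _ f g)
  | |- computable (fun x => @?f x * @?g x) => apply: (@comp_mul _ _ f g)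
  | |- computable (fun x => @?f x ^ @?g x) => apply: (@comp_exp _ _ f g)
  | |- computable (fun x => @?f x <= @?g x) => apply: (@comp_leq _ _ f g)
  | |- computable (fun x => nfst (@?f x)) => apply: (@comp_nfst _ _ f)
  | |- computable (fun x => nsnd (@?f x)) => apply: (@comp_nsnd _ _ f)
  | |- computable (fun x => nat_rect (fun=> ?U) (@?f x) (@?g x) (@?h x)) =>
      apply: (@comp_rec _ U _ _ h f g)
  | H : computable ?q |- computable ?q => exact: H
  | H : computable ?q |- computable (fun x => ?q (@?f x)) =>
      apply: (@comp_comp _ _ _ _ _ _ q f H)
  | |- _ => apply: comp_if
  end; cbv beta.

Section comp_tab.
Context (T : Type) {eT : encoding T}.

Lemma comp_nth (U : Type) {eU : encoding U} (x0 : U) (s : T -> seq U)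
    (i : T -> nat) :
  computable s -> computable i -> computable (fun x => nth x0 (s x) (i x)).
Proof.
move=> cs ci.
have -> : (fun x => nth x0 (s x) (i x)) = fun x => head x0
    (nat_rect (fun=> seq U) (s x) (fun _ r => behead r) (i x)).
  apply/funext => x; have -> : nat_rect (fun=> seq U) (s x)
      (fun _ r => behead r) (i x) = drop (i x) (s x).
    elim: (i x) => [|n /= ->]; first by rewrite drop0.
    by rewrite -drop1 drop_drop add1n.
  by rewrite -nth0 nth_drop addn0.
apply: comp_head; repeat comp_nat_step.
exact/comp_behead/comp_snd/comp_id.
Qed.

Lemma comp_mkseq (U : Type) {eU : encoding U} (f : T -> nat -> U)
    (n : T -> nat) : computable (fun p => f p.1 p.2) -> computable n ->
  computable (fun x => mkseq (f x) (n x)).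
Proof.
move=> cf cn.
(* The list is built backwards: stage k holds its last k entries. *)
have -> : (fun x => mkseq (f x) (n x)) = fun x =>
    nat_rect (fun=> seq U) [::] (fun k s => f x (n x - k.+1) :: s) (n x).
  apply/funext => x; rewrite /mkseq.
  have H k : k <= n x -> nat_rect (fun=> seq U) [::]
      (fun k s => f x (n x - k.+1) :: s) k = map (f x) (iota (n x - k) k).
    elim: k => [//|k IH] lek /=.
    by rewrite IH; [rewrite -[in RHS]subSn ?subSS | exact: ltnW].
  by rewrite H // subnn.
repeat comp_nat_step; apply: comp_cons; last by repeat comp_nat_step.
apply: (comp_comp cf (f := fun p => (p.1.1, n p.1.1 - p.1.2.+1))).
by repeat comp_nat_step.
Qed.

End comp_tab.

(** The truncated binary logarithm; it recovers the length n of a string from its code 2 ^ n + j. *)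
Definition nlog c :=
  nat_rect (fun=> nat) 0 (fun k s => s + (2 ^ k.+1 <= c)) c.

Lemma nlogE n j : j < 2 ^ n -> nlog (2 ^ n + j) = n.
Proof.
move=> jn; have H m : nat_rect (fun=> nat) 0
    (fun k s => s + (2 ^ k.+1 <= 2 ^ n + j)) m = minn m n.
  elim: m => [|m IH]; first by rewrite min0n.
  rewrite [LHS]/= [X in X + _]IH; have [le|lt] := leqP m.+1 n.
    by rewrite (leq_trans (leq_pexp2l _ le)) ?leq_addr // addn1 !(minn_idPl _) // ltnW.
  have -> : 2 ^ m.+1 <= 2 ^ n + j = false.
    apply/negbTE; rewrite -ltnNge (@leq_trans (2 ^ n.+1)) ?leq_pexp2l //.
    by rewrite expnS mul2n -addnn ltn_add2l.
  by rewrite addn0 !(minn_idPr _) // ltnW.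
rewrite /nlog H; apply/minn_idPr; rewrite (leq_trans _ (leq_addr _ _)) //.
exact/ltnW/ltn_expl.
Qed.

(** Division by [d.+1], the form in which fractions store their denominators. *)
Definition ndivS m d := nat_rect (fun=> nat) 0 (fun k s => s + (k.+1 * d.+1 <= m)) m.

Lemma ndivSE m d : ndivS m d = m %/ d.+1.
Proof.
have H n : nat_rect (fun=> nat) 0 (fun k s => s + (k.+1 * d.+1 <= m)) n =
    minn n (m %/ d.+1).
  elim: n => [|n IH]; first by rewrite min0n.
  rewrite [LHS]/= [X in X + _]IH -leq_divRL //.
  have [le|lt] := leqP n.+1 (m %/ d.+1).
    by rewrite addn1 !(minn_idPl _) // ltnW.
  by rewrite addn0 !(minn_idPr _) // ltnW.
by rewrite /ndivS H; apply/minn_idPr/leq_div.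
Qed.

(** * Fractions *)

(* [(a, b, d)] stands for (a - b) / (d + 1). *)
Definition natfrac := (nat * nat * nat)%type.

Definition frac_add (x y : natfrac) : natfrac :=
  (x.1.1 * y.2.+1 + y.1.1 * x.2.+1, x.1.2 * y.2.+1 + y.1.2 * x.2.+1,
   (x.2.+1 * y.2.+1).-1).

Definition frac_opp (x : natfrac) : natfrac := (x.1.2, x.1.1, x.2).

Definition frac_mul (x y : natfrac) : natfrac :=
  (x.1.1 * y.1.1 + x.1.2 * y.1.2, x.1.1 * y.1.2 + x.1.2 * y.1.1,
   (x.2.+1 * y.2.+1).-1).

Definition frac_le (x y : natfrac) : bool :=
  x.1.1 * y.2.+1 + y.1.2 * x.2.+1 <= y.1.1 * x.2.+1 + x.1.2 * y.2.+1.

Definition frac_min (x y : natfrac) : natfrac := if frac_le x y then x else y.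
Definition frac_max (x y : natfrac) : natfrac := if frac_le x y then y else x.

Definition frac_nat (n : nat) : natfrac := (n, 0, 0).
Definition frac_pow2V (n : nat) : natfrac := (1, 0, (2 ^ n).-1).

(** The extrema range over the n + 1 indices 0, ..., n, whereas [frac_sum] has n terms. The order on
    fractions is decidable, so these extrema are exact. *)
Definition frac_bigmin (s : nat -> natfrac) (n : nat) : natfrac :=
  nat_rect (fun=> natfrac) (s 0) (fun k m => frac_min m (s k.+1)) n.
Definition frac_bigmax (s : nat -> natfrac) (n : nat) : natfrac :=
  nat_rect (fun=> natfrac) (s 0) (fun k m => frac_max m (s k.+1)) n.
Definition frac_sum (s : nat -> natfrac) (n : nat) : natfrac :=
  nat_rect (fun=> natfrac) (frac_nat 0) (fun k m => frac_add m (s k)) n.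

Section comp_frac.
Context (T : Type) {eT : encoding T}.
Implicit Types f g : T -> natfrac.

Lemma comp_nlog (f : T -> nat) : computable f -> computable (fun x => nlog (f x)).
Proof. by move=> cf; rewrite /nlog; repeat comp_nat_step. Qed.

Lemma comp_ndivS (f g : T -> nat) : computable f -> computable g ->
  computable (fun x => ndivS (f x) (g x)).
Proof. by move=> cf cg; rewrite /ndivS; repeat comp_nat_step. Qed.

Lemma comp_frac_add f g : computable f -> computable g ->
  computable (fun x => frac_add (f x) (g x)).
Proof. by move=> cf cg; rewrite /frac_add; repeat comp_nat_step. Qed.

Lemma comp_frac_opp f : computable f -> computable (fun x => frac_opp (f x)).
Proof. by move=> cf; rewrite /frac_opp; repeat comp_nat_step. Qed.

Lemma comp_frac_mul f g : computable f -> computable g ->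
  computable (fun x => frac_mul (f x) (g x)).
Proof. by move=> cf cg; rewrite /frac_mul; repeat comp_nat_step. Qed.

Lemma comp_frac_min f g : computable f -> computable g ->
  computable (fun x => frac_min (f x) (g x)).
Proof. by move=> cf cg; rewrite /frac_min /frac_le; repeat comp_nat_step. Qed.

Lemma comp_frac_max f g : computable f -> computable g ->
  computable (fun x => frac_max (f x) (g x)).
Proof. by move=> cf cg; rewrite /frac_max /frac_le; repeat comp_nat_step. Qed.

Lemma comp_frac_nat (f : T -> nat) : computable f ->
  computable (fun x => frac_nat (f x)).
Proof. by move=> cf; rewrite /frac_nat; repeat comp_nat_step. Qed.

Lemma comp_frac_pow2V (f : T -> nat) : computable f ->
  computable (fun x => frac_pow2V (f x)).
Proof. by move=> cf; rewrite /frac_pow2V; repeat comp_nat_step. Qed.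

End comp_frac.

Section comp_frac_big.
Context (T : Type) {eT : encoding T}.

Lemma comp_frac_big (op : natfrac -> natfrac -> natfrac) (x0 : T -> natfrac)
    (s : T -> nat -> natfrac) (n : T -> nat) :
  computable (fun p => op p.1 p.2) -> computable x0 ->
  computable (fun p => s p.1 p.2) -> computable n ->
  computable (fun x =>
    nat_rect (fun=> natfrac) (x0 x) (fun k m => op m (s x k)) (n x)).
Proof.
move=> cop cx cs cn; repeat comp_nat_step.
apply: (comp_comp cop (f := fun p => (p.2, s p.1.1 p.1.2))).
repeat comp_nat_step.
by apply: (comp_comp cs (f := fun p => p.1)); repeat comp_nat_step.
Qed.

Lemma comp_frac_sum (s : T -> nat -> natfrac) (n : T -> nat) :
  computable (fun p => s p.1 p.2) -> computable n ->
  computable (fun x => frac_sum (s x) (n x)).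
Proof.
move=> cs cn; apply: (@comp_frac_big frac_add) => //; last exact: comp_cst.
by apply: (@comp_frac_add _ _ fst snd); repeat comp_nat_step.
Qed.

Lemma comp_frac_bigmin (s : T -> nat -> natfrac) (n : T -> nat) :
  computable (fun p => s p.1 p.2) -> computable n ->
  computable (fun x => frac_bigmin (s x) (n x)).
Proof.
move=> cs cn; apply: (@comp_frac_big frac_min _ (fun x k => s x k.+1)) => //.
- by apply: (@comp_frac_min _ _ fst snd); repeat comp_nat_step.
- by apply: (comp_comp cs (f := fun p => (p, 0))); repeat comp_nat_step.
- by apply: (comp_comp cs (f := fun p => (p.1, p.2.+1))); repeat comp_nat_step.
Qed.

Lemma comp_frac_bigmax (s : T -> nat -> natfrac) (n : T -> nat) :
  computable (fun p => s p.1 p.2) -> computable n ->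
  computable (fun x => frac_bigmax (s x) (n x)).
Proof.
move=> cs cn; apply: (@comp_frac_big frac_max _ (fun x k => s x k.+1)) => //.
- by apply: (@comp_frac_max _ _ fst snd); repeat comp_nat_step.
- by apply: (comp_comp cs (f := fun p => (p, 0))); repeat comp_nat_step.
- by apply: (comp_comp cs (f := fun p => (p.1, p.2.+1))); repeat comp_nat_step.
Qed.

End comp_frac_big.

Ltac comp_step :=
  match goal with
  | |- computable (fun x => nlog (@?f x)) => apply: (@comp_nlog _ _ f)
  | |- computable (fun x => ndivS (@?f x) (@?g x)) => apply: (@comp_ndivS _ _ f g)
  | |- computable (fun x => frac_add (@?f x) (@?g x)) =>
      apply: (@comp_frac_add _ _ f g)
  | |- computable (fun x => frac_mul (@?f x) (@?g x)) =>
      apply: (@comp_frac_mul _ _ f g)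
  | |- computable (fun x => frac_opp (@?f x)) => apply: (@comp_frac_opp _ _ f)
  | |- computable (fun x => frac_nat (@?f x)) => apply: (@comp_frac_nat _ _ f)
  | |- computable (fun x => frac_pow2V (@?f x)) => apply: (@comp_frac_pow2V _ _ f)
  | |- computable (fun x => frac_sum (@?f x) (@?g x)) =>
      apply: (@comp_frac_sum _ _ f g)
  | |- computable (fun x => frac_bigmin (@?f x) (@?g x)) =>
      apply: (@comp_frac_bigmin _ _ f g)
  | |- computable (fun x => frac_bigmax (@?f x) (@?g x)) =>
      apply: (@comp_frac_bigmax _ _ f g)
  | |- computable (fun x => nth ?x0 (@?f x) (@?g x)) =>
      apply: (@comp_nth _ _ _ _ x0 f g)
  | |- computable (fun x => mkseq (@?f x) (@?g x)) =>
      apply: (@comp_mkseq _ _ _ _ f g)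
  | |- _ => comp_nat_step
  end; cbv beta.

Local Open Scope classical_set_scope.
Local Open Scope ring_scope.

Definition fval (F : realFieldType) (x : natfrac) : F :=
  (x.1.1%:R - x.1.2%:R) / x.2.+1%:R.

Section fval_theory.
Context (F : realFieldType).
Implicit Types x y : natfrac.

Let neq0 n : n.+1%:R != 0 :> F. Proof. by rewrite pnatr_eq0. Qed.

Let predM (m n : nat) : ((m.+1 * n.+1).-1.+1)%:R = m.+1%:R * n.+1%:R :> F.
Proof. by rewrite prednK ?muln_gt0 // natrM. Qed.

Lemma fval_add x y : fval F (frac_add x y) = fval F x + fval F y.
Proof.
rewrite /fval /frac_add /= predM !natrD !natrM; field.
by rewrite !nat1r !neq0.
Qed.

Lemma fval_opp x : fval F (frac_opp x) = - fval F x.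
Proof. by rewrite /fval /frac_opp /= -mulNr opprB. Qed.

Lemma fval_mul x y : fval F (frac_mul x y) = fval F x * fval F y.
Proof.
rewrite /fval /frac_mul /= predM !natrD !natrM; field.
by rewrite !nat1r !neq0.
Qed.

Lemma fval_nat n : fval F (frac_nat n) = n%:R.
Proof. by rewrite /fval /= subr0 divr1. Qed.

Lemma fval_pow2V n : fval F (frac_pow2V n) = 2 ^- n.
Proof.
by rewrite /fval /= subr0 prednK ?expn_gt0 // natrX div1r.
Qed.

Lemma frac_leE x y : frac_le x y = (fval F x <= fval F y).
Proof.
rewrite /frac_le /fval ler_pdivrMr ?ltr0n // mulrAC ler_pdivlMr ?ltr0n //.
by rewrite !mulrBl lerBlDr addrAC lerBrDr -!natrM -!natrD ler_nat.
Qed.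

Lemma frac_bigminP (s : nat -> natfrac) n :
  (forall i, (i <= n)%N -> fval F (frac_bigmin s n) <= fval F (s i)) /\
  (exists2 i, (i <= n)%N & fval F (frac_bigmin s n) = fval F (s i)).
Proof.
elim: n => [|n [IH1 [i lein IH2]]] /=.
  by split; [case|exists 0%N].
rewrite /frac_min frac_leE -/(frac_bigmin s n); case: leP => [le|/ltW lt].
- split; last by exists i; rewrite // leqW.
  by move=> k; rewrite leq_eqVlt => /predU1P[->|/IH1].
- split; last by exists n.+1.
  move=> k; rewrite leq_eqVlt => /predU1P[->//|/IH1].
  exact: le_trans.
Qed.

Lemma frac_bigmaxP (s : nat -> natfrac) n :
  (forall i, (i <= n)%N -> fval F (s i) <= fval F (frac_bigmax s n)) /\
  (exists2 i, (i <= n)%N & fval F (frac_bigmax s n) = fval F (s i)).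
Proof.
elim: n => [|n [IH1 [i lein IH2]]] /=.
  by split; [case|exists 0%N].
rewrite /frac_max frac_leE -/(frac_bigmax s n); case: leP => [le|/ltW lt].
- split; last by exists n.+1.
  move=> k; rewrite leq_eqVlt => /predU1P[->//|/IH1] H.
  exact: le_trans le.
- split; last by exists i; rewrite // leqW.
  by move=> k; rewrite leq_eqVlt => /predU1P[->|/IH1].
Qed.

Lemma fval_sum (s : nat -> natfrac) n :
  fval F (frac_sum s n) = \sum_(i < n) fval F (s i).
Proof.
elim: n => [|n IH] /=; first by rewrite fval_nat big_ord0.
by rewrite fval_add IH big_ord_recr.
Qed.

Lemma ratr_fval x : ratr (fval rat x) = fval F x.
Proof. by rewrite /fval fmorph_div rmorphB !rmorph_nat. Qed.

End fval_theory.

Arguments frac_sum : simpl never.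
Arguments frac_bigmin : simpl never.
Arguments frac_bigmax : simpl never.

Lemma computable_rat_dseqP q : computable_rat_dseq q <->
  exists2 F : nat * nat -> natfrac, computable F &
    forall n k, q n k = fval rat (F (n, k)).
Proof.
split=> [[a [b [d [ca cb cd qE]]]]|[F cF FE]].
  exists (fun p => (a p.1 p.2, b p.1 p.2, d p.1 p.2)); last exact: qE.
  by do 2?apply: comp_pair; apply/comp_computable2.
exists (fun n k => (F (n, k)).1.1), (fun n k => (F (n, k)).1.2).
exists (fun n k => (F (n, k)).2); split=> //.
- by apply/(comp_computable2 (fun p => (F p).1.1)); repeat comp_step.
- by apply/(comp_computable2 (fun p => (F p).1.2)); repeat comp_step.
- by apply/(comp_computable2 (fun p => (F p).2)); repeat comp_step.
Qed.

(** The increments after stage n add up to at most 2 ^- n. *)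
Lemma cauchy_name_dist (R : realType) q (x : R) n :
  cauchy_name q x -> `|ratr (q n) - x| <= 2 ^- n.
Proof.
move=> [qc qx].
have qcR m : `|ratr (q m.+1) - ratr (q m) : R| <= 2 ^- m.+1.
  have := qc m.+1 isT; rewrite -(ler_rat R) ratr_norm rmorphB /=.
  by rewrite fmorphV rmorphXn /= ratr_nat.
(* The subtracted term 2 ^- (n + m) makes the induction on m go through. *)
have H m : `|ratr (q (n + m)%N) - ratr (q n) : R| <= 2 ^- n - 2 ^- (n + m).
  elim: m => [|m IH]; first by rewrite addn0 !subrr normr0.
  have := qcR (n + m)%N; rewrite -addnS => H.
  have E : (2 : R) ^- (n + m) = 2 ^- (n + m.+1) * 2.
    by rewrite addnS exprS invfM mulrAC mulVf ?mul1r.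
  rewrite E in IH; apply: le_trans (ler_distD (ratr (q (n + m)%N)) _ _) _.
  lra.
have H' m : (n <= m)%N -> `|ratr (q m) - ratr (q n) : R| <= 2 ^- n.
  move=> nm; rewrite -(subnKC nm); apply: le_trans (H _) _.
  by rewrite lerBlDr lerDl invr_ge0 exprn_ge0.
rewrite leNgt; apply/negP => lt.
have e0 : 0 < `|ratr (q n) - x| - 2 ^- n by rewrite subr_gt0.
have /cvgrPdist_lt /(_ _ e0) [N _ HN] := qx.
have /= := HN (n + N)%N (leq_addl _ _).
have /= := H' (n + N)%N (leq_addr _ _).
have := ler_distD (ratr (q (n + N)%N)) (ratr (q n)) x.
rewrite (distrC _ (ratr (q n))) (distrC x).
lra.
Qed.

Lemma near_pow2V_le (R : realType) (e : R) :
  0 < e -> \forall n \near \oo, (2 : R) ^- n <= e.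
Proof.
move=> e0; have h : `|2^-1 : R| < 1 by rewrite ger0_norm; lra.
have /cvgrPdist_le/(_ e e0) : (fun n => 2^-1 ^+ n : R) @ \oo --> (0 : R).
  exact: cvg_expr.
apply: filterS => n; rewrite sub0r normrN exprVn.
by rewrite ger0_norm // invr_ge0 exprn_ge0.
Qed.

Lemma pow2V_ge0 (F : realFieldType) n : 0 <= (2 : F) ^- n.
Proof. by rewrite invr_ge0 exprn_ge0. Qed.

Lemma pow2V_gt0 (F : realFieldType) n : 0 < (2 : F) ^- n.
Proof. by rewrite invr_gt0 exprn_gt0. Qed.

Lemma pow2VD (F : realFieldType) m n : (2 : F) ^- (m + n) = 2 ^- m * 2 ^- n.
Proof. by rewrite exprD invfM. Qed.

Lemma pow2VS (F : realFieldType) n : (2 : F) ^- n.+1 = 2 ^- n / 2.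
Proof. by rewrite exprSr invfM. Qed.

(** The shift by 2 brings consecutive terms close enough: 2 ^- (n + 3) + 2 ^- (n + 2) <= 2 ^- (n +
    1). *)
Lemma cauchy_name_of_dist (R : realType) p (x : R) :
  (forall n, `|ratr (p n) - x| <= 2 ^- n) -> cauchy_name (fun n => p n.+2) x.
Proof.
move=> H; split.
  case=> // n _ /=; rewrite -(ler_rat R) ratr_norm rmorphB /=.
  rewrite fmorphV rmorphXn /= ratr_nat.
  apply: le_trans (ler_distD x _ _) _; rewrite [`|x - _|]distrC.
  have := H n.+3; have := H n.+2; have := pow2V_ge0 R n.+1.
  rewrite !(pow2VS _ n.+2) !(pow2VS _ n.+1); lra.
apply/cvgrPdist_le => e e0.
apply: filterS (near_pow2V_le e0) => n le.
rewrite distrC; apply: le_trans (H _) _; apply: le_trans le.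
have := pow2V_ge0 R n; rewrite !pow2VS; lra.
Qed.

(** * Computability on dyadic rationals *)

Section dyadic.
Context (R : realType).
Implicit Types (G : nat -> R -> R) (f g : R -> R).

(** The precision is tied to the grid, but a dyadic point can be written with a larger denominator,
    which yields its value to any precision. Nothing is asked off the grid, so [G k] may jump.
    Uniformity in k is what allows a sequence to be summed. *)
Definition dyadic_computable G :=
  exists2 q : nat * nat * nat -> natfrac, computable q &
    forall k n j, (j <= 2 ^ n)%N ->
      `|fval R (q (k, n, j)) - G k (j%:R / 2 ^+ n)| <= 2 ^- n.

Lemma natr_pow2V_le (F : realFieldType) n : n%:R * 2 ^- n <= 1 :> F.
Proof. by rewrite ler_pdivrMr ?exprn_gt0 // mul1r -natrX ler_nat ltnW // ltn_expl. Qed.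

Lemma dyadicDM n m j :
  (j * 2 ^ m)%:R / 2 ^+ (n + m) = j%:R / 2 ^+ n :> R.
Proof.
rewrite exprD natrM natrX; field.
by rewrite !expf_neq0.
Qed.

(** Errors that are [E k] times too large are absorbed by a grid finer by [E k] levels, because E <=
    2 ^ E. *)
Lemma dyadic_computable_weaken G (q : nat * nat * nat -> natfrac) (E : nat -> nat) :
  computable q -> computable E ->
  (forall k n j, (j <= 2 ^ n)%N ->
    `|fval R (q (k, n, j)) - G k (j%:R / 2 ^+ n)| <= (E k)%:R * 2 ^- n) ->
  dyadic_computable G.
Proof.
move=> cq cE H.
exists (fun p => q (p.1.1, p.1.2 + E p.1.1, p.2 * 2 ^ E p.1.1)%N).
  by repeat comp_step.
move=> k n j jn /=; have := H k (n + E k)%N (j * 2 ^ E k)%N.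
rewrite dyadicDM expnD leq_mul2r jn orbT => /(_ isT) /le_trans; apply.
rewrite pow2VD mulrCA ler_piMr ?pow2V_ge0 //.
exact: natr_pow2V_le.
Qed.

Lemma dyadic_computable_reindex G (phi : nat -> nat) :
  computable phi -> dyadic_computable G ->
  dyadic_computable (fun k => G (phi k)).
Proof.
move=> cphi [q cq qE]; exists (fun p => q (phi p.1.1, p.1.2, p.2)).
  by repeat comp_step.
by move=> k n j; exact: qE.
Qed.

Lemma dyadic_in01 n j : (j <= 2 ^ n)%N -> 0 <= (j%:R / 2 ^+ n : R) <= 1.
Proof.
move=> jn; rewrite divr_ge0 ?exprn_ge0 //=.
by rewrite ler_pdivrMr ?exprn_gt0 // mul1r -natrX ler_nat.
Qed.

(** All dyadic points of [0,1] form one computable sequence, indexed by pairs (n, j) with j clipped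
    to 2 ^ n; clause (a) of computability applies to it. *)
Lemma computable_fun01_dyadic f :
  computable_fun01 f -> dyadic_computable (fun=> f).
Proof.
move=> [cf _].
pose X c := (nfst c, minn (nsnd c) (2 ^ nfst c)).
pose x c : R := (X c).2%:R / 2 ^+ (X c).1.
have /cf : forall k, 0 <= x k <= 1 by move=> k; apply/dyadic_in01/geq_minr.
case.
  exists (fun c _ => fval rat (frac_mul (frac_nat (X c).2) (frac_pow2V (X c).1))).
  split.
    apply/computable_rat_dseqP.
    exists (fun p => frac_mul (frac_nat (nsnd p.1 - (nsnd p.1 - 2 ^ nfst p.1)))
        (frac_pow2V (nfst p.1)))%N; first by repeat comp_step.
    by move=> c n; rewrite /= minnE.
  move=> c; split.
    by move=> n _; rewrite subrr normr0 pow2V_ge0.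
  have -> : (fun=> ratr (fval rat (frac_mul (frac_nat (X c).2)
      (frac_pow2V (X c).1)))) = fun _ : nat => x c.
    apply/funext => _; rewrite ratr_fval fval_mul fval_nat fval_pow2V.
    by rewrite /x.
  exact: cvg_cst.
move=> q [/computable_rat_dseqP[Q cQ QE] qx].
exists (fun p => Q (npair p.1.2 p.2, p.1.2)).
  apply: (comp_comp cQ (f := fun p => (npair p.1.2 p.2, p.1.2))).
  apply: comp_pair; last by repeat comp_step.
  apply: (comp_app2 (f := npair)); first exact: computable2_npair.
    by repeat comp_step.
  by repeat comp_step.
move=> k n j jn; have := cauchy_name_dist n (qx (npair n j)).
by rewrite QE ratr_fval /x /X /= npairK1 npairK2 (minn_idPl jn).
Qed.

(** A name of x is rounded to a grid fine enough for the modulus [h], and g is evaluated at the grid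
    point. *)
Lemma dyadic_computable_fun01 g (h : nat -> nat) :
  dyadic_computable (fun=> g) -> computable h ->
  (forall (n : nat) (x y : R), 0 <= x <= 1 -> 0 <= y <= 1 ->
       `|x - y| < 2 ^- h n -> `|g x - g y| < 2 ^- n) ->
  computable_fun01 g.
Proof.
move=> [q cq qg] ch hg; split; last first.
  by exists h; split; [exact/comp_computable1|].
move=> x x01 [X [/computable_rat_dseqP[Q cQ QE] qx]].
(* The grid point is within 2 * 2 ^- N m of x, which is below 2 ^- h (m + 1); the summand m + 3 also
   brings the error of [q] at this level below 2 ^- (m + 1). *)
pose N m := (h m.+1 + m + 3)%N.
(* Rounds the approximation of [x k] down to the grid; truncated subtraction clips it at 0 and
   [minn] at 1. *)
pose j k m := let y := Q (k, N m) in
  minn (ndivS ((y.1.1 - y.1.2) * 2 ^ N m) y.2) (2 ^ N m).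
have jle k m : (j k m <= 2 ^ N m)%N by exact: geq_minr.
have jx k m : `|(j k m)%:R / 2 ^+ N m - x k| <= 2 ^- N m * 2.
  have := cauchy_name_dist (N m) (qx k); rewrite QE ratr_fval /j.
  case: (Q (k, N m)) => [[a b] d] /=; rewrite ndivSE.
  set n := N m; set J := (_ %/ _)%N; set y := fval R _ => yx.
  have /andP[x0 x1] := x01 k.
  pose Y : R := (a - b)%:R / d.+1%:R.
  have /andP[JY YJ] : J%:R * 2 ^- n <= Y < J.+1%:R * 2 ^- n.
    rewrite ler_pdivlMr ?ltr0n // mulrAC ler_pdivrMr ?exprn_gt0 //.
    rewrite ltr_pdivrMr ?ltr0n // mulrAC ltr_pdivlMr ?exprn_gt0 //.
    rewrite -natrX -!natrM ler_nat ltr_nat leq_trunc_div /=.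
    exact: ltn_ceil.
  have Yx : `|Y - x k| <= 2 ^- n.
    have [ab|ba] := leqP a b; last first.
      move: yx; rewrite /y /fval /Y /= natrB // ltnW //.
    move: yx; rewrite /Y /y /fval /= (eqP ab) mul0r sub0r normrN (ger0_norm x0).
    have : (a%:R - b%:R) / d.+1%:R <= 0 :> R.
      by rewrite pmulr_lle0 ?invr_gt0 ?ltr0n // subr_le0 ler_nat.
    move: (_ / _) => w w0; rewrite ler_norml => /andP[+ _].
    by move: w0; lra.
  have p0 := pow2V_ge0 R n; rewrite -natr1 mulrDl mul1r in YJ.
  have -> : (minn J (2 ^ n))%:R / 2 ^+ n = Num.min (J%:R * 2 ^- n) 1 :> R.
    have E i : (i%:R * 2 ^- n <= 1 :> R) = (i <= 2 ^ n)%N.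
      by rewrite ler_pdivrMr ?exprn_gt0 // mul1r -natrX ler_nat.
    have [le|lt] := leqP J (2 ^ n).
      by rewrite min_l // E.
    by rewrite min_r; [rewrite natrX divff ?expf_neq0|rewrite ltW // ltNge E -ltnNge].
  rewrite ler_norml in Yx; rewrite ler_norml; case/andP: Yx => *.
  by rewrite /Num.min; case: ltP => ?; lra.
pose P p := q (0%N, N p.2, j p.1 p.2).
pose p k m := fval rat (P (k, m)).
have cP : computable P.
  rewrite /P /j /N; under [X in computable X]eq_fun do rewrite minnE.
  by repeat comp_step.
have pg k m : `|ratr (p k m) - g (x k)| <= 2 ^- m.
  rewrite ratr_fval /P /=.
  apply: le_trans (ler_distD (g ((j k m)%:R / 2 ^+ N m)) _ _) _.
  have := qg 0%N _ _ (jle k m) => H1.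
  have lt : `|(j k m)%:R / 2 ^+ N m - x k| < 2 ^- h m.+1.
    apply: le_lt_trans (jx k m) _; rewrite /N !pow2VD.
    have : 2 ^- h m.+1 * 2 ^- m <= 2 ^- h m.+1 :> R.
      by rewrite ler_piMr ?pow2V_ge0 // invf_le1 ?exprn_gt0 // exprn_ege1 // ler1n.
    have := pow2V_gt0 R (h m.+1).
    by rewrite !pow2VS expr0 invr1; lra.
  have := hg m.+1 _ _ (dyadic_in01 (jle k m)) (x01 k) lt.
  have : 2 ^- N m <= 2 ^- m.+1 :> R.
    rewrite lef_pV2 ?posrE ?exprn_gt0 // ler_eXn2l ?ltr1n //.
    by rewrite /N; lia.
  move: H1; rewrite pow2VS /=; lra.
exists (fun k m => p k m.+2); split.
  apply/computable_rat_dseqP; exists (fun p => P (p.1, p.2.+2)) => //.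
  by repeat comp_step.
by move=> k; exact: cauchy_name_of_dist.
Qed.

End dyadic.

(** * Martingales and nondecreasing functions *)

Definition string_val (s : seq bool) : nat :=
  foldl (fun (n : nat) (b : bool) => n.*2 + b)%N 0%N s.

Lemma string_val_rcons s b : string_val (rcons s b) = ((string_val s).*2 + b)%N.
Proof. by rewrite /string_val foldl_rcons. Qed.

Lemma string_val_lt s : (string_val s < 2 ^ size s)%N.
Proof.
elim/last_ind: s => // s b IH; rewrite string_val_rcons size_rcons expnS.
by case: b; lia.
Qed.

Lemma string_codeE s : string_code s = (2 ^ size s + string_val s)%N.
Proof.
elim/last_ind: s => // s b IH; rewrite string_val_rcons size_rcons expnS.
by rewrite /string_code foldl_rcons -/(string_code s) IH; lia.
Qed.

Fixpoint bits n j : seq bool :=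
  if n is n'.+1 then rcons (bits n' j./2) (odd j) else [::].

Lemma size_bits n j : size (bits n j) = n.
Proof. by elim: n j => //= n IH j; rewrite size_rcons IH. Qed.

Lemma string_val_bits n j : (j < 2 ^ n)%N -> string_val (bits n j) = j.
Proof.
elim: n j => [|n IH] j; first by rewrite expn0 ltnS leqn0 => /eqP ->.
rewrite expnS => jn; rewrite /= string_val_rcons IH; last by lia.
by rewrite addnC odd_double_half.
Qed.

Lemma bits_string_val s : bits (size s) (string_val s) = s.
Proof.
elim/last_ind: s => // s b IH; rewrite string_val_rcons size_rcons /=.
by rewrite addnC half_bit_double IH oddD odd_double addbF oddb.
Qed.

Section slope_martingale.
Context (R : realType).
Implicit Types (g : R -> R) (Z : nat -> bool) (z : R).

(** The partial sums of the expansion are the left endpoints, and the remaining digits contribute at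
    most 2 ^- n. *)
Lemma binary_expansion_itv Z z n : binary_expansion Z z ->
  let j := string_val (mkseq Z n) in
  j%:R / 2 ^+ n <= z <= j.+1%:R / 2 ^+ n.
Proof.
move=> [Zz _] /=; set u := series _ in Zz.
have uE m : (string_val (mkseq Z m))%:R / 2 ^+ m = u m.
  elim: m => [|m IH]; first by rewrite /u /series /= big_geq // mul0r.
  rewrite mkseqS /u seriesSr -/u -IH string_val_rcons.
  rewrite natrD -mul2n natrM exprS; field.
  by rewrite expf_neq0.
have un : {homo u : m p / (m <= p)%N >-> m <= p}.
  apply/nondecreasing_seqP => m.
  by rewrite /u seriesSr lerDl divr_ge0 // exprn_ge0.
have le m : u m <= z.
  rewrite -(cvg_lim (@Rhausdorff R) Zz).
  by apply: nondecreasing_cvgn_le => //; apply/cvg_ex; exists z.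
rewrite uE le /= -(cvg_lim (@Rhausdorff R) Zz).
rewrite -[in leRHS]natr1 mulrDl uE.
apply: limr_le; first by apply/cvg_ex; exists z.
exists n => // m /= nm.
have H p : u (n + p)%N <= u n + 1 / 2 ^+ n - 1 / 2 ^+ (n + p).
  elim: p => [|p IH]; first by rewrite addn0 addrK.
  rewrite addnS /u seriesSr -/u.
  have : (Z (n + p)%N)%:R / 2 ^+ (n + p).+1 <= 1 / 2 ^+ (n + p).+1 :> R.
    by rewrite ler_pM2r ?invr_gt0 ?exprn_gt0 // (ler_nat _ _ 1) leq_b1.
  have : 1 / 2 ^+ (n + p) = 1 / 2 ^+ (n + p).+1 * 2 :> R.
    by rewrite exprS; field; rewrite expf_neq0.
  move: IH; lra.
rewrite -(subnKC nm); apply: le_trans (H _) _.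
by rewrite gerBl divr_ge0 // exprn_ge0.
Qed.

Definition slope_martingale g s : R :=
  (g ((string_val s).+1%:R / 2 ^+ size s) - g ((string_val s)%:R / 2 ^+ size s))
    * 2 ^+ size s.

Lemma slope_martingaleP g : nondecreasing01 g -> martingale (slope_martingale g).
Proof.
move=> gnd; split=> s.
  rewrite mulr_ge0 ?exprn_ge0 // subr_ge0.
  have lt := string_val_lt s.
  apply: gnd; rewrite ?in_itv /=; first exact/dyadic_in01/ltnW.
    exact/dyadic_in01.
  by rewrite ler_pM2r ?invr_gt0 ?exprn_gt0 // ler_nat.
rewrite /slope_martingale !string_val_rcons !size_rcons addn0 addn1 exprS.
have E j : j.*2%:R / (2 * 2 ^+ size s) = j%:R / 2 ^+ size s :> R.
  rewrite -mul2n natrM; field.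
  by rewrite expf_neq0.
by rewrite -doubleS !E; ring.
Qed.

Lemma slope_martingale_computable g :
  dyadic_computable (fun=> g) -> computable_on_strings (slope_martingale g).
Proof.
move=> [q cq qg].
(* The factor 2 ^ n in the slope, n = [nlog c], costs n bits of precision; 3 more bits cover the
   errors of the two endpoint values. *)
pose N c m := (nlog c + (m + 3))%N.
pose v c m j := q (0, N c m, j * 2 ^ (m + 3))%N.
pose P p := frac_mul (frac_nat (2 ^ nlog p.1))
  (frac_add (v p.1 p.2 (p.1 - 2 ^ nlog p.1).+1)
    (frac_opp (v p.1 p.2 (p.1 - 2 ^ nlog p.1))))%N.
have cP : computable P by rewrite /P /v /N; repeat comp_step.
exists (fun c m => fval rat (P (c, m.+2))); split.
  by apply/computable_rat_dseqP; exists (fun p => P (p.1, p.2.+2)) => //;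
    repeat comp_step.
move=> s; apply: (@cauchy_name_of_dist _ (fun m => fval rat (P (string_code s, m)))).
move=> m; rewrite ratr_fval /P string_codeE /= nlogE ?string_val_lt //.
rewrite addKn fval_mul fval_add fval_opp fval_nat natrX /slope_martingale.
have lt := string_val_lt s; set j := string_val s in lt *.
set n := size s in lt *.
have H i : (i <= 2 ^ n)%N ->
    `|fval R (v (2 ^ n + j)%N m i) - g (i%:R / 2 ^+ n)| <= 2 ^- (n + (m + 3)).
  move=> le; rewrite /v /N nlogE //.
  have := qg 0%N (n + (m + 3))%N (i * 2 ^ (m + 3))%N.
  rewrite dyadicDM; apply.
  by rewrite (expnD _ n) leq_mul2r le orbT.
have H1 := H j.+1 lt; have H2 := H j (ltnW lt).
set a := fval R _ in H1 *; set b := fval R _ in H2 *.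
rewrite [X in `|_ - X|]mulrC -mulrBr normrM ger0_norm ?exprn_ge0 //.
rewrite -ler_pdivlMl ?exprn_gt0 //.
have : 2 ^- (n + (m + 3)) * 8 = (2 ^+ n)^-1 * 2 ^- m :> R.
  by rewrite !pow2VD !pow2VS expr0; field; rewrite ?expf_neq0.
have := pow2V_ge0 R (n + (m + 3)).
move: H1 H2; rewrite !ler_norml => /andP[? ?] /andP[? ?] ? ?.
by apply/andP; split; lra.
Qed.

(** Derivative +oo at z, expressed by chords around z, with z allowed as an endpoint: the dyadic
    intervals that contain z are such chords. *)
Definition steep_at g z := forall K : R, exists2 d : R, 0 < d &
  forall x y, 0 <= x <= z -> z <= y <= 1 -> y - x < d ->
    K * (y - x) <= g y - g x.

Lemma steep_at_not_random g z Z :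
  nondecreasing01 g -> dyadic_computable (fun=> g) -> steep_at g z ->
  binary_expansion Z z -> ~ computably_random_seq R Z.
Proof.
move=> gnd gd st Zz /(_ _ (slope_martingaleP gnd) (slope_martingale_computable gd)).
apply=> -[B HB]; have [d d0 Hd] := st (B + 1).
have d20 : 0 < d / 2 by lra.
have [n _ Hn] := near_pow2V_le d20.
have {}Hn := Hn n (leqnn n); rewrite /= in Hn.
have := HB _ (ex_intro2 _ _ n I erefl); rewrite /slope_martingale size_mkseq.
have /andP[xz zy] := binary_expansion_itv n Zz.
have lt := string_val_lt (mkseq Z n); rewrite size_mkseq in lt.
set j := string_val _ in xz zy lt *.
have E : j.+1%:R / 2 ^+ n - j%:R / 2 ^+ n = 2 ^- n :> R.
  by rewrite -mulrBl -natr1 addrAC subrr add0r mul1r.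
have := Hd (j%:R / 2 ^+ n) (j.+1%:R / 2 ^+ n); rewrite E xz zy.
have /andP[-> _] := dyadic_in01 R (ltnW lt).
have /andP[_ ->] := dyadic_in01 R lt.
have dn : 2 ^- n < d by apply: le_lt_trans Hn _; lra.
move=> /(_ isT isT dn); rewrite ler_pdivrMr ?exprn_gt0 //.
by move=> /le_trans H /H; rewrite gerDl ler10.
Qed.

End slope_martingale.

Section martingale_cdf.
Context (R : realType) (M : seq bool -> R) (mM : martingale M).

(** The mass of the first j intervals of level n when the interval of s has mass M s / 2 ^ size
    s. *)
Let cdf n j : R := \sum_(i < j) M (bits n i) / 2 ^+ n.

Let cdfS n j : cdf n j.+1 = cdf n j + M (bits n j) / 2 ^+ n.
Proof. by rewrite /cdf big_ord_recr. Qed.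

(** The martingale equality says that the mass is additive when an interval is halved. *)
Let cdf_double n j : cdf n.+1 j.*2 = cdf n j.
Proof.
elim: j => [|j IH]; first by rewrite /cdf double0 !big_ord0.
rewrite doubleS !cdfS IH -addrA; congr +%R.
rewrite /= odd_double doubleK uphalf_double -mulrDl mM.2 exprS.
by field; rewrite expf_neq0.
Qed.

Let cdf_refine n m j : cdf (n + m) (j * 2 ^ m) = cdf n j.
Proof.
elim: m => [|m IH]; first by rewrite addn0 muln1.
by rewrite addnS expnS mulnCA mul2n cdf_double.
Qed.

Let cdf_le n i j : (i <= j)%N -> cdf n i <= cdf n j.
Proof.
move=> /subnKC <-; elim: (j - i)%N => [|k]; first by rewrite addn0.
move=> /le_trans; apply; rewrite addnS cdfS lerDl.
by rewrite divr_ge0 ?exprn_ge0 // mM.1.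
Qed.

Let cdf_total n : cdf n (2 ^ n) = M [::].
Proof.
have := cdf_refine 0 n 1; rewrite add0n mul1n => ->.
by rewrite cdfS /cdf big_ord0 add0r expr0 divr1.
Qed.

Let cdf_mono n i m j : i%:R / 2 ^+ n <= j%:R / 2 ^+ m :> R -> cdf n i <= cdf m j.
Proof.
rewrite ler_pdivrMr ?exprn_gt0 // mulrAC ler_pdivlMr ?exprn_gt0 //.
rewrite -!natrX -!natrM ler_nat => le.
by rewrite -(cdf_refine n m) -(cdf_refine m n) addnC cdf_le.
Qed.

(** The grid values are extended to all reals by the supremum over dyadic points on the left, which
    leaves them unchanged at dyadic points. *)
Lemma martingale_cdf : computable_on_strings M -> exists F : R -> R,
  [/\ nondecreasing01 F, dyadic_computable (fun=> F),
      forall x, 0 <= x <= 1 -> 0 <= F x <= M [::]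
    & forall s, F ((string_val s).+1%:R / 2 ^+ size s)
        - F ((string_val s)%:R / 2 ^+ size s) = M s / 2 ^+ size s].
Proof.
move=> [q [/computable_rat_dseqP[Q cQ QE] qM]].
pose S (x : R) := [set y : R | exists n j,
  [/\ (j <= 2 ^ n)%N, j%:R / 2 ^+ n <= x & y = cdf n j]].
pose F x := sup (S x).
have Sub x y : S x y -> y <= M [::].
  by move=> [n [j [jn _ ->]]]; rewrite -(cdf_total n); apply: cdf_le.
have SB x : has_ubound (S x) by exists (M [::]) => y; exact: Sub.
have S0 x : 0 <= x -> S x 0.
  by move=> x0; exists 0%N, 0%N; rewrite mul0r /cdf big_ord0.
have FE n j : (j <= 2 ^ n)%N -> F (j%:R / 2 ^+ n) = cdf n j.
  move=> jn; apply/eqP; rewrite eq_le; apply/andP; split.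
    apply: ge_sup; first by exists 0; apply: S0; rewrite divr_ge0 // exprn_ge0.
    by move=> _ [m [i [_ /cdf_mono le ->]]].
  by apply: ub_le_sup => //; exists n, j.
exists F; split.
- move=> x y; rewrite !in_itv /= => /andP[x0 _] _ xy.
  apply: ge_sup; first by exists 0; exact: S0.
  move=> _ [n [j [jn jx ->]]]; apply: ub_le_sup => //.
  by exists n, j; split=> //; exact: le_trans xy.
(* 2 ^ n + i codes the i-th string of length n. Each of the at most 2 ^ n terms has error 2 ^- n and
   weight 2 ^- n. *)
- exists (fun p => frac_mul (frac_pow2V p.1.2)
    (frac_sum (fun i => Q (2 ^ p.1.2 + i, p.1.2)%N) p.2)).
    by repeat comp_step.
  move=> k n j jn /=; rewrite FE // fval_mul fval_sum fval_pow2V /cdf.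
  rewrite -mulr_suml mulrC -mulrBl normrM -sumrB.
  rewrite [X in _ * X]ger0_norm ?pow2V_ge0 // ler_piMl ?pow2V_ge0 //.
  apply: le_trans (ler_norm_sum _ _ _) _.
  apply: (@le_trans _ _ (\sum_(i < j) 2 ^- n)).
    apply: ler_sum => i _; have lt := leq_trans (ltn_ord i) jn.
    have := cauchy_name_dist n (qM (bits n i)).
    by rewrite QE ratr_fval string_codeE size_bits string_val_bits.
  rewrite sumr_const card_ord -(mulr_natl _ j) ler_pdivrMr ?exprn_gt0 //.
  by rewrite mul1r -natrX ler_nat.
- move=> x /andP[x0 _]; rewrite ub_le_sup /=; [|exact: SB|exact: S0].
  by apply: ge_sup; [exists 0; exact: S0|move=> y; exact: Sub].
- move=> s; have lt := string_val_lt s; rewrite (FE _ _ lt) (FE _ _ (ltnW lt)).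
  by rewrite cdfS bits_string_val addrAC subrr add0r.
Qed.

End martingale_cdf.

(** * Functions with infinite derivative at a point *)

Section steep_family.
Context (R : realType).
Implicit Types (g : R -> R) (H : nat -> R -> R) (z : R).

(* [2 ^ k * H k] is at most [2 ^- k] but has slope at least [2 ^ (k - 1)] at z. *)
Definition steep_family H z :=
  [/\ dyadic_computable H,
      forall k x, 0 <= x <= 1 -> 0 <= H k x <= 4 ^- k,
      forall k x y, 0 <= x -> x <= y -> y <= 1 -> 0 <= H k y - H k x <= y - x
    & forall k, exists2 d, 0 < d &
        forall x y, 0 <= x <= z -> z <= y <= 1 -> y - x < d ->
          (y - x) / 2 <= H k y - H k x].

(** g is the sum of the 2 ^ k H k. Near z the n-th term alone has slope at least 2 ^ (n - 1), and
    the other terms do not decrease, so the derivative is +oo. The terms are at most 2 ^- k, so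
    partial sums approximate g uniformly. *)
Lemma steep_family_fun H z : steep_family H z -> exists g,
  [/\ computable_fun01 g, nondecreasing01 g, dyadic_computable (fun=> g)
    & steep_at g z].
Proof.
move=> [[q cq qH] H01 HL Hz].
have pow4 k : 4 ^- k = 2 ^- k * 2 ^- k :> R.
  by rewrite -invfM -exprMn; congr (_ ^+ _)^-1; ring.
pose u x : nat -> R := series (fun k => 2 ^+ k * H k x).
have uS x n : u x n.+1 = u x n + 2 ^+ n * H n x by rewrite /u seriesSr.
have umono x : 0 <= x <= 1 -> {homo u x : m n / (m <= n)%N >-> m <= n}.
  move=> x01; apply/nondecreasing_seqP => n.
  by rewrite uS lerDl mulr_ge0 ?exprn_ge0 //; case/andP: (H01 n x x01).
have tail x n m : 0 <= x <= 1 ->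
    u x (n + m)%N <= u x n + 2 ^- n * 2 - 2 ^- (n + m) * 2.
  move=> x01; elim: m => [|m IH]; first by rewrite addn0 addrK.
  rewrite addnS uS; have /andP[_] := H01 (n + m)%N x x01.
  rewrite -(ler_pM2l (exprn_gt0 (n + m) (ltr0n R 2))) pow4 mulrA.
  rewrite divff ?expf_neq0 // mul1r.
  by move: IH; rewrite !pow2VS; lra.
have tail' x n m : 0 <= x <= 1 -> u x m <= u x n + 2 ^- n * 2.
  move=> x01; have [mn|/ltnW nm] := leqP m n.
    by rewrite (le_trans (umono x x01 _ _ mn)) // lerDl mulr_ge0 ?pow2V_ge0.
  rewrite -(subnKC nm); apply: le_trans (tail _ _ _ x01) _.
  by rewrite gerBl mulr_ge0 ?pow2V_ge0.
pose g x := limn (u x).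
have ucvg x : 0 <= x <= 1 -> cvgn (u x).
  move=> x01; apply: nondecreasing_is_cvgn; first exact: umono.
  by exists (u x 0%N + 2 ^- 0 * 2) => _ [n _ <-]; exact: tail'.
have ug x n : 0 <= x <= 1 -> u x n <= g x <= u x n + 2 ^- n * 2.
  move=> x01; apply/andP; split.
    by apply: nondecreasing_cvgn_le; [exact: umono|exact: ucvg].
  by apply: limr_le; [exact: ucvg|near=> m; exact: tail'].
have uD x y n : 0 <= x -> x <= y -> y <= 1 -> 0 <= u y n - u x n.
  move=> x0 xy y1; elim: n => [|n]; first by rewrite /u /series /= !big_geq // subrr.
  have := HL n _ _ x0 xy y1 => /andP[+ _]; rewrite !uS !subr_ge0 => le1 le2.
  by rewrite lerD // ler_pM2l ?exprn_gt0.
have gD x y n : 0 <= x -> x <= y -> y <= 1 ->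
    2 ^+ n * (H n y - H n x) <= g y - g x.
  move=> x0 xy y1; apply/ler_addgt0Pr => e e0.
  have e20 : 0 < e / 2 by lra.
  have [N _ /(_ (N + n.+1)%N (leq_addr _ _)) /= le] := near_pow2V_le e20.
  have x01 : 0 <= x <= 1 by rewrite x0 (le_trans xy).
  have y01 : 0 <= y <= 1 by rewrite y1 (le_trans x0).
  have /andP[_] := ug x (N + n.+1)%N x01; have /andP[+ _] := ug y (N + n.+1)%N y01.
  have : 2 ^+ n * (H n y - H n x) <= u y (N + n.+1)%N - u x (N + n.+1)%N.
    elim: N {le} => [|N IH].
      by rewrite add0n !uS; have := uD _ _ n x0 xy y1; lra.
    rewrite addSn !uS; have /andP[] := HL (N + n.+1)%N _ _ x0 xy y1.
    move=> /(mulr_ge0 (exprn_ge0 (N + n.+1)%N (ler0n R 2))) + _.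
    by move: IH; lra.
  by move: le; lra.
have gnd : nondecreasing01 g.
  move=> x y; rewrite !in_itv /= => /andP[x0 _] /andP[_ y1] xy.
  rewrite -subr_ge0 (le_trans _ (gD _ _ 0%N x0 xy y1)) // expr0 mul1r.
  by have /andP[] := HL 0%N _ _ x0 xy y1.
have uL x y n : 0 <= x -> x <= y -> y <= 1 -> u y n - u x n <= 2 ^+ n * (y - x).
  move=> x0 xy y1; elim: n => [|n IH].
    by rewrite /u /series /= !big_geq // subrr expr0 mul1r subr_ge0.
  have /andP[_] := HL n _ _ x0 xy y1.
  rewrite -(ler_pM2l (exprn_gt0 n (ltr0n R 2))) !uS exprS.
  by move: IH; lra.
have gd : dyadic_computable (fun=> g).
  (* n + 2 terms leave a tail of at most 2 ^- n / 2; their weights add up to less than 2 ^ (n + 2),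
     so precision 2 ^- (2n + 4) for each term costs at most 2 ^- n / 4 in total. *)
  pose N n := (n + n + 4)%N.
  exists (fun p => frac_sum (fun k => frac_mul (frac_nat (2 ^ k))
      (q (k, N p.1.2, p.2 * 2 ^ (p.1.2 + 4)))) p.1.2.+2)%N.
    by rewrite /N; repeat comp_step.
  move=> _ n j jn /=; set x := j%:R / 2 ^+ n.
  have x01 : 0 <= x <= 1 by exact: dyadic_in01.
  have := ug x n.+2 x01; rewrite fval_sum.
  set s := \sum_(_ < _) _; suff : `|s - u x n.+2| <= 2 ^- n / 4.
    rewrite !ler_norml !pow2VS => /andP[? ?] /andP[? ?].
    by have := pow2V_ge0 R n; move=> ?; apply/andP; split; lra.
  have Ns : 2 ^- N n * (2 ^+ n.+2) = 2 ^- n / 4 :> R.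
    by rewrite /N !exprD !exprS expr0; field; rewrite expf_neq0.
  rewrite -Ns /s /u /series /= big_mkord -sumrB.
  apply: le_trans (ler_norm_sum _ _ _) _.
  have : \sum_(i < n.+2) 2 ^+ i * 2 ^- N n <= 2 ^- N n * 2 ^+ n.+2 :> R.
    rewrite -mulr_suml [leRHS]mulrC ler_pM2r ?pow2V_gt0 //.
    elim: n.+2 => [|m IH]; first by rewrite big_ord0 exprn_ge0.
    by rewrite big_ord_recr /= exprS; lra.
  apply: le_trans; apply: ler_sum => i _.
  rewrite fval_mul fval_nat natrX -mulrBr normrM ger0_norm ?exprn_ge0 //.
  rewrite ler_pM2l ?exprn_gt0 //.
  have := qH i (N n) (j * 2 ^ (n + 4))%N.
  rewrite /N -addnA dyadicDM; apply.
  by rewrite (expnD _ n (n + 4)) leq_mul2r jn orbT.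
exists g; split=> //; last first.
  move=> K; have [n Kn] : exists n : nat, K <= 2 ^+ n / 2.
    exists (Num.truncn (`|K|)).+2.
    have := natr_pow2V_le R (Num.truncn `|K|).+1.
    rewrite ler_pdivrMr ?exprn_gt0 // mul1r [X in _ -> _ <= X / _]exprS.
    have /andP[_ lt] := truncn_itv (normr_ge0 K).
    have := ler_norm K; move: lt; lra.
  have [d d0 Hd] := Hz n; exists d => // x y /andP[x0 xz] /andP[zy y1] yx.
  have xy := le_trans xz zy.
  apply: le_trans (gD _ _ n x0 xy y1).
  have := Hd x y; rewrite x0 xz zy y1 => /(_ isT isT yx).
  rewrite -(ler_pM2l (exprn_gt0 n (ltr0n R 2))); apply: le_trans.
  by rewrite mulrCA mulrC ler_wpM2l // ?subr_ge0 //; lra.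
(* The partial sum of n + 3 terms is 2 ^ (n + 3)-Lipschitz and within 2 ^- n / 4 of g. For arguments
   closer than 2 ^- (2n + 6) it varies by at most 2 ^- n / 8. *)
apply: (@dyadic_computable_fun01 _ g (fun n => n + n + 6)%N) => //.
  by repeat comp_step.
move=> n x y; wlog xy : x y / x <= y.
  move=> W x01 y01; have [xy|/ltW yx] := leP x y; first exact: W.
  by rewrite distrC [`|g x - _|]distrC; exact: W.
move=> x01 y01; have /andP[x0 _] := x01; have /andP[_ y1] := y01.
rewrite distrC ger0_norm ?subr_ge0 // => lt.
rewrite distrC ger0_norm ?subr_ge0; last by apply: gnd; rewrite ?in_itv.
have := uL _ _ (n + 3)%N x0 xy y1; have /andP[_] := ug y (n + 3)%N y01.
have /andP[+ _] := ug x (n + 3)%N x01.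
have : 2 ^+ (n + 3) * (y - x) <= 2 ^- n / 8.
  have -> : 2 ^- n / 8 = 2 ^+ (n + 3) * 2 ^- (n + n + 6) :> R.
    by rewrite !exprD !exprS expr0; field; rewrite expf_neq0.
  by rewrite ler_pM2l ?exprn_gt0 // ltW.
have := pow2V_gt0 R n; rewrite pow2VD !pow2VS expr0 invr1.
by lra.
Unshelve. all: by end_near.
Qed.

End steep_family.

(** * One-sided envelopes *)

Section envelopes.
Context (R : realType).
Implicit Types (v g f : R -> R).

Definition bounded01 v := exists B, forall y, 0 <= y <= 1 -> `|v y| <= B.

Definition sup_right v x := sup [set v y | y in [set y | x <= y <= 1]].
Definition inf_left v x := inf [set v y | y in [set y | 0 <= y <= x]].

Lemma sup_right_ge v x y : bounded01 v -> 0 <= x -> x <= y <= 1 ->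
  v y <= sup_right v x.
Proof.
move=> [B vB] x0 xy1; apply: ub_le_sup; last by exists y.
exists B => _ [t /andP[xt t1] <-].
by rewrite (le_trans (ler_norm _)) // vB // t1 (le_trans x0).
Qed.

Lemma sup_right_le v x b : x <= 1 -> (forall y, x <= y <= 1 -> v y <= b) ->
  sup_right v x <= b.
Proof.
move=> x1 vb; apply: ge_sup; first by exists (v x), x => //=; rewrite lexx.
by move=> _ [y /vb ? <-].
Qed.

Lemma inf_left_le v x y : bounded01 v -> x <= 1 -> 0 <= y <= x ->
  inf_left v x <= v y.
Proof.
move=> [B vB] x1 y0x; apply: ge_inf; last by exists y.
exists (- B) => _ [t /andP[t0 tx] <-].
by rewrite lerNl (le_trans (ler_norm _)) // normrN vB // t0 (le_trans tx).
Qed.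

Lemma inf_left_ge v x b : 0 <= x -> (forall y, 0 <= y <= x -> b <= v y) ->
  b <= inf_left v x.
Proof.
move=> x1 vb; apply: lb_le_inf; first by exists (v x), x => //=; rewrite lexx x1.
by move=> _ [y /vb ? <-].
Qed.

Lemma sup_right_anti v x y : bounded01 v -> 0 <= x -> x <= y -> y <= 1 ->
  sup_right v y <= sup_right v x.
Proof.
move=> vB x0 xy y1; apply: sup_right_le => // t /andP[yt t1].
by apply: sup_right_ge; rewrite ?t1 ?(le_trans xy).
Qed.

Lemma inf_left_anti v x y : bounded01 v -> 0 <= x -> x <= y -> y <= 1 ->
  inf_left v y <= inf_left v x.
Proof.
move=> vB x0 xy y1; apply: inf_left_ge => // t /andP[t0 tx].
by apply: inf_left_le; rewrite ?t0 ?(le_trans tx).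
Qed.

(** The rising-sun mechanism: where v lies in the shadow of its values further right, [sup_right v]
    is constant, and the upper envelope then has exactly the increments of f. *)
Lemma sup_right_const v x y : bounded01 v -> 0 <= x -> x <= y -> y <= 1 ->
  (forall t, x <= t < y -> v t <= sup_right v y) ->
  sup_right v x = sup_right v y.
Proof.
move=> vB x0 xy y1 vt; apply: le_anti; rewrite [X in _ && X]sup_right_anti // andbT.
apply: sup_right_le; first exact: le_trans y1.
move=> t /andP[xt t1]; have [yt|ty] := leP y t.
  by apply: sup_right_ge; rewrite ?yt ?(le_trans x0).
by rewrite vt // xt.
Qed.

Lemma inf_left_const v x y : bounded01 v -> 0 <= x -> x <= y -> y <= 1 ->
  (forall t, x < t <= y -> inf_left v x <= v t) ->
  inf_left v x = inf_left v y.
Proof.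
move=> vB x0 xy y1 vt; apply: le_anti; rewrite [X in _ && X]inf_left_anti // andbT.
apply: inf_left_ge; first exact: le_trans xy.
move=> t /andP[t0 ty]; have [tx|xt] := leP t x.
  by apply: inf_left_le; rewrite ?tx ?t0 ?(le_trans xy).
by rewrite vt // xt.
Qed.

(** The least function above g whose increments are at most those of f; [lower_envelope g f] is the
    greatest such function below g. They are U, for f the identity, and L. *)
Definition upper_envelope g f x := sup_right (g \- f) x + f x.
Definition lower_envelope g f x := inf_left (g \- f) x + f x.

Lemma nondecreasing01_bounded f : nondecreasing01 f -> bounded01 f.
Proof.
move=> fnd; exists (`|f 0| + `|f 1|) => y y01; have /andP[y0 y1] := y01.
have := fnd 0 y; have := fnd y 1; rewrite !in_itv /= !lexx y01 ler01.
move=> /(_ isT isT y1) H1 /(_ isT isT y0) H2.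
rewrite ler_norml; have := ler_norm (f 1); have := ler_norm (- f 0).
have := normr_ge0 (f 0); have := normr_ge0 (f 1); rewrite normrN => *.
by apply/andP; split; lra.
Qed.

Lemma bounded01B g f : bounded01 g -> bounded01 f -> bounded01 (g \- f).
Proof.
move=> [A gA] [B fB]; exists (A + B) => y y01 /=.
by rewrite (le_trans (ler_normB _ _)) // lerD ?gA ?fB.
Qed.

Context (g f : R -> R) (gnd : nondecreasing01 g) (fnd : nondecreasing01 f).

Let bgf : bounded01 (g \- f).
Proof. by apply: bounded01B; exact: nondecreasing01_bounded. Qed.

Let nd (h : R -> R) x y : nondecreasing01 h -> 0 <= x -> x <= y -> y <= 1 -> h x <= h y.
Proof.
move=> hnd x0 xy y1; apply: hnd; rewrite // in_itv /=.
  by rewrite x0 (le_trans xy).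
by rewrite y1 (le_trans x0).
Qed.

Lemma upper_envelope_itv x : 0 <= x <= 1 -> g x <= upper_envelope g f x <= g 1.
Proof.
move=> /andP[x0 x1]; apply/andP; split.
  by rewrite -lerBlDr; apply: (@sup_right_ge (g \- f)); rewrite ?lexx.
rewrite -lerBrDr; apply: sup_right_le => // y /andP[xy y1] /=.
by apply: lerB; apply: nd => //; exact: le_trans xy.
Qed.

Lemma upper_envelope_increment x y : 0 <= x -> x <= y -> y <= 1 ->
  0 <= upper_envelope g f y - upper_envelope g f x <= f y - f x.
Proof.
move=> x0 xy y1; apply/andP; split; last first.
  by rewrite opprD addrACA gerDr subr_le0; exact: sup_right_anti.
have y0 := le_trans x0 xy.
rewrite subr_ge0 -lerBrDr; apply: sup_right_le; first exact: le_trans y1.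
move=> t /andP[xt t1] /=; have [yt|/ltW ty] := leP y t.
  have : (g \- f) t <= sup_right (g \- f) y by apply: sup_right_ge; rewrite ?yt.
  have := nd fnd x0 xy y1; rewrite /upper_envelope /=; lra.
(* A point t between x and y is replaced by y, since g t <= g y and f x <= f t. *)
have : (g \- f) y <= sup_right (g \- f) y by apply: sup_right_ge; rewrite ?lexx.
have := nd gnd (le_trans x0 xt) ty y1; have := nd fnd x0 xt t1.
by rewrite /upper_envelope /=; lra.
Qed.

Lemma lower_envelope_itv x : 0 <= x <= 1 -> g 0 <= lower_envelope g f x <= g x.
Proof.
move=> /andP[x0 x1]; apply/andP; split; last first.
  by rewrite -lerBrDr; apply: (@inf_left_le (g \- f)); rewrite ?lexx ?x0.
rewrite -lerBlDr; apply: inf_left_ge => // y /andP[y0 yx] /=.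
by apply: lerB; apply: nd => //; exact: le_trans x1.
Qed.

Lemma lower_envelope_increment x y : 0 <= x -> x <= y -> y <= 1 ->
  0 <= lower_envelope g f y - lower_envelope g f x <= f y - f x.
Proof.
move=> x0 xy y1; apply/andP; split; last first.
  by rewrite opprD addrACA gerDr subr_le0; exact: inf_left_anti.
have y0 := le_trans x0 xy; have x1 := le_trans xy y1.
rewrite subr_ge0 -lerBlDr; apply: inf_left_ge => //.
move=> t /andP[t0 ty] /=; have [tx|/ltW xt] := leP t x.
  have : inf_left (g \- f) x <= (g \- f) t by apply: inf_left_le; rewrite ?t0.
  have := nd fnd x0 xy y1; rewrite /lower_envelope /=; lra.
have : inf_left (g \- f) x <= (g \- f) x by apply: inf_left_le; rewrite ?lexx ?x0.
have := nd gnd x0 xt (le_trans ty y1); have := nd fnd t0 ty y1.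
by rewrite /lower_envelope /=; lra.
Qed.

End envelopes.

(** * Approximation of envelopes on dyadic grids *)

Section envelope_grid.
Context (R : realType).
Implicit Types (v : R -> R).

Lemma grid_lower n j (y : R) : 0 <= y -> y <= j%:R / 2 ^+ n ->
  exists2 i, (i <= j)%N & i%:R / 2 ^+ n <= y <= i%:R / 2 ^+ n + 2 ^- n.
Proof.
move=> y0 yj; have p0 : 0 < 2 ^+ n :> R by rewrite exprn_gt0.
have /andP[le lt] := truncn_itv (mulr_ge0 y0 (ltW p0)).
exists (Num.truncn (y * 2 ^+ n)).
  by rewrite -(ler_nat R) (le_trans le) // -ler_pdivlMr.
rewrite ler_pdivrMr // le /= -[X in _ + X]mul1r -mulrDl natr1.
by rewrite ler_pdivlMr // ltW.
Qed.

Lemma grid_upper n j (y : R) : 0 <= y -> y <= j%:R / 2 ^+ n ->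
  exists2 i, (i <= j)%N & y <= i%:R / 2 ^+ n <= y + 2 ^- n.
Proof.
move=> y0 yj; have [i ij /andP[iy yi]] := grid_lower y0 yj.
have p0 := pow2V_ge0 R n.
have [lt|ge] := ltnP i j.
  by exists i.+1 => //; rewrite -natr1 mulrDl mul1r yi lerD2r.
have E : i = j by apply/eqP; rewrite eqn_leq ge ij.
by exists j => //; rewrite yj -E (le_trans iy) // lerDl.
Qed.

(** [e1] is the price of restricting the infimum to the grid, [e2] that of approximating v there. In
    the uses below v is a difference of nondecreasing functions, one of them 1-Lipschitz: rounding y
    in the direction that favours the other one costs at most 2 ^- n, whatever its jumps. *)
Lemma grid_inf_left v (s : nat -> natfrac) n j (e1 e2 : R) :
  bounded01 v -> (j <= 2 ^ n)%N ->
  (forall y, 0 <= y -> y <= j%:R / 2 ^+ n ->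
    exists2 i, (i <= j)%N & v (i%:R / 2 ^+ n) <= v y + e1) ->
  (forall i, (i <= j)%N -> `|fval R (s i) - v (i%:R / 2 ^+ n)| <= e2) ->
  0 <= e1 -> `|fval R (frac_bigmin s j) - inf_left v (j%:R / 2 ^+ n)| <= e1 + e2.
Proof.
move=> vB jn ve1 se2 e10; have [le [i ij iE]] := frac_bigminP R s j.
have /andP[j0 j1] := dyadic_in01 R jn.
have p0 : 0 < 2 ^+ n :> R by rewrite exprn_gt0.
rewrite ler_norml; apply/andP; split.
  rewrite iE lerBrDr addrC -lerBrDr.
  have : inf_left v (j%:R / 2 ^+ n) <= v (i%:R / 2 ^+ n).
    apply: inf_left_le => //; rewrite divr_ge0 ?exprn_ge0 //=.
    by rewrite ler_pM2r ?invr_gt0 // ler_nat.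
  by have := se2 _ ij; rewrite ler_norml => /andP[+ _]; lra.
rewrite lerBlDr -lerBlDl; apply: inf_left_ge => // y /andP[y0 yj].
have [k kj vk] := ve1 _ y0 yj; have := le _ kj; have := se2 _ kj.
by rewrite ler_norml => /andP[_]; move: vk; lra.
Qed.

Lemma grid_sup_right v (s : nat -> natfrac) n j (e1 e2 : R) :
  bounded01 v -> (j <= 2 ^ n)%N ->
  (forall y, j%:R / 2 ^+ n <= y -> y <= 1 ->
    exists2 i, (j <= i <= 2 ^ n)%N & v y <= v (i%:R / 2 ^+ n) + e1) ->
  (forall i, (i <= 2 ^ n)%N -> `|fval R (s i) - v (i%:R / 2 ^+ n)| <= e2) ->
  0 <= e1 ->
  `|fval R (frac_bigmax (fun i => s (j + i)%N) (2 ^ n - j))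
     - sup_right v (j%:R / 2 ^+ n)| <= e1 + e2.
Proof.
move=> vB jn ve1 se2 e10.
have [le [i ij iE]] := frac_bigmaxP R (fun i => s (j + i)%N) (2 ^ n - j).
have /andP[j0 j1] := dyadic_in01 R jn.
have p0 : 0 < 2 ^+ n :> R by rewrite exprn_gt0.
have jin : (j + i <= 2 ^ n)%N by lia.
rewrite ler_norml; apply/andP; split; last first.
  rewrite iE.
  have : v ((j + i)%:R / 2 ^+ n) <= sup_right v (j%:R / 2 ^+ n).
    apply: sup_right_ge => //; have /andP[_ ->] := dyadic_in01 R jin.
    by rewrite andbT ler_pM2r ?invr_gt0 // ler_nat leq_addr.
  by have := se2 _ jin; rewrite ler_norml => /andP[_]; lra.
rewrite lerBrDr addrC -lerBrDr opprK; apply: sup_right_le => // y /andP[jy y1].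
have [k /andP[jk kn] vk] := ve1 _ jy y1; have := se2 _ kn.
have := le (k - j)%N; rewrite subnKC // leq_sub2r // => /(_ isT).
by move=> ?; rewrite ler_norml => /andP[+ _]; move: vk; lra.
Qed.

End envelope_grid.

(** * Steep families from steep chords around a point *)

Section steep_chords.
Context (R : realType).
Implicit Types (F : R -> R) (z : R).

Lemma nondecreasing01_id : nondecreasing01 (fun x : R => x).
Proof. by []. Qed.

Lemma nondecreasing01Z (c : R) f : 0 <= c -> nondecreasing01 f ->
  nondecreasing01 (fun x => c * f x).
Proof. by move=> c0 fnd x y x01 y01 xy; rewrite ler_wpM2l // fnd. Qed.

(** Near z, on each side, at least one of the two envelopes has slope 1 and the other does not
    decrease; the average therefore has slope at least 1/2, the factor in [steep_family]. *)
Let env F k x :=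
  (upper_envelope (fun y => 4 ^- k * F y) (fun y => y) x
   + lower_envelope (fun y => 4 ^- k * F y) (fun y => y) x) / 2.

Let pow4V_ge0 k : 0 <= 4 ^- k :> R.
Proof. by rewrite invr_ge0 exprn_ge0. Qed.

Let dyadic_computable_env F : nondecreasing01 F ->
  dyadic_computable (fun=> F) -> dyadic_computable (env F).
Proof.
move=> Fnd [q cq qF].
pose s k n i := frac_add (frac_mul (frac_pow2V (k + k)) (q (0, n, i)%N))
  (frac_opp (frac_mul (frac_nat i) (frac_pow2V n))).
pose Q p := let k := p.1.1 in let n := p.1.2 in let j := p.2 in
  frac_add (frac_mul (frac_pow2V 1)
     (frac_add (frac_bigmax (fun i => s k n (j + i)%N) (2 ^ n - j))
               (frac_bigmin (s k n) j)))
   (frac_mul (frac_nat j) (frac_pow2V n)).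
(* Each extremum is off by at most 2 * 2 ^- n, hence so is their average. *)
apply: (@dyadic_computable_weaken _ _ Q (fun=> 2%N)).
- by rewrite /Q /s; repeat comp_step.
- exact: comp_cst.
move=> k n j jn; rewrite /Q /=.
rewrite !(fval_add, fval_mul) fval_nat !fval_pow2V expr1.
pose v : R -> R := (fun y => 4 ^- k * F y) \- (fun y => y).
have vB : bounded01 v.
  by apply/bounded01B; apply/nondecreasing01_bounded => //; exact: nondecreasing01Z.
have sv i : (i <= 2 ^ n)%N -> `|fval R (s k n i) - v (i%:R / 2 ^+ n)| <= 2 ^- n.
  move=> le; rewrite /s fval_add fval_opp !fval_mul fval_nat !fval_pow2V /v /=.
  have -> : 2 ^- (k + k) = 4 ^- k :> R.
    by rewrite exprD -exprMn; congr (_ ^+ _)^-1; ring.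
  rewrite (_ : _ - _ = 4 ^- k * (fval R (q (0, n, i)%N) - F (i%:R / 2 ^+ n)));
    last by ring.
  rewrite normrM ger0_norm //.
  rewrite -[leRHS]mul1r ler_pM // ?qF //.
  by rewrite invf_le1 ?exprn_gt0 // exprn_ege1 // ler1n.
have p0 := pow2V_ge0 R n.
have Fle x y : 0 <= x -> x <= y -> y <= 1 -> 4 ^- k * F x <= 4 ^- k * F y.
  move=> x0 xy y1; rewrite ler_wpM2l //; apply: Fnd; rewrite // in_itv /=.
    by rewrite x0 (le_trans xy).
  by rewrite y1 (le_trans x0).
have /andP[j0 j1] := dyadic_in01 R jn.
have Hs : `|fval R (frac_bigmax (fun i => s k n (j + i)%N) (2 ^ n - j))
     - sup_right v (j%:R / 2 ^+ n)| <= 2 ^- n + 2 ^- n.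
  apply: grid_sup_right => // y jy y1.
  have y0 := le_trans j0 jy.
  have [|i le /andP[yi iy]] := @grid_upper R n (2 ^ n) y y0.
    by rewrite natrX divff ?expf_neq0.
  exists i.
    rewrite le andbT -(ler_nat R) -(@ler_pM2r _ (2 ^- n)) ?pow2V_gt0 //.
    exact: le_trans yi.
  have := Fle _ _ y0 yi; have /andP[_ ->] := dyadic_in01 R le.
  by move=> /(_ isT); rewrite /v /=; move: iy; lra.
have Hi : `|fval R (frac_bigmin (s k n) j)
     - inf_left v (j%:R / 2 ^+ n)| <= 2 ^- n + 2 ^- n.
  apply: grid_inf_left => //; last first.
    by move=> i ij; apply: sv; exact: leq_trans jn.
  move=> y y0 yj.
  have [i le /andP[iy yi]] := grid_lower y0 yj.
  exists i => //.
  have := Fle (i%:R / 2 ^+ n) y _ iy (le_trans yj j1).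
  rewrite divr_ge0 ?exprn_ge0 // => /(_ isT).
  by rewrite /v /=; move: yi; lra.
rewrite /env /upper_envelope /lower_envelope -/v.
move: Hs Hi; rewrite !ler_norml => /andP[? ?] /andP[? ?].
by apply/andP; split; lra.
Qed.

(* [F] may jump at [z]: then the upper envelope is steep on the left of [z] and the
   lower one on its right. *)
Lemma steep_family_of_chords F z :
  nondecreasing01 F -> dyadic_computable (fun=> F) ->
  (forall x, 0 <= x <= 1 -> 0 <= F x <= 1) ->
  (forall r : R, exists a b,
    [/\ 0 <= a <= z, z <= b <= 1, a < z \/ z = 0, z < b \/ z = 1
      & r * (b - a) < F b - F a]) ->
  exists H, steep_family H z.
Proof.
move=> Fnd Fd F01 Fz; exists (env F).
have E k x : 0 <= x <= 1 -> 0 <= 4 ^- k * F x <= 4 ^- k.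
  move=> /F01/andP[F0 F1]; rewrite mulr_ge0 //= -[leRHS]mulr1 ler_wpM2l //.
have nd k : nondecreasing01 (fun y => 4 ^- k * F y) by exact: nondecreasing01Z.
have idnd := nondecreasing01_id.
split.
- exact: dyadic_computable_env.
- move=> k x x01; rewrite /env.
  have := upper_envelope_itv (nd k) idnd x01.
  have := lower_envelope_itv (nd k) idnd x01.
  have /andP[? _] : 0 <= 4 ^- k * F 0 <= 4 ^- k by apply: E; rewrite lexx ler01.
  have /andP[_ ?] : 0 <= 4 ^- k * F 1 <= 4 ^- k by apply: E; rewrite lexx ler01.
  have /andP[? ?] := E k x x01.
  by move=> /andP[? ?] /andP[? ?]; apply/andP; split; lra.
- move=> k x y x0 xy y1; rewrite /env.
  have /andP[? ?] := upper_envelope_increment (nd k) idnd x0 xy y1.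
  have /andP[? ?] := lower_envelope_increment (nd k) idnd x0 xy y1.
  by apply/andP; split; lra.
- move=> k; have [a [b [/andP[a0 az] /andP[zb b1] az' zb' ab]]] := Fz (4 ^+ k).
  pose v : R -> R := (fun y => 4 ^- k * F y) \- (fun y => y).
  have vB : bounded01 v.
    by apply/bounded01B; apply/nondecreasing01_bounded.
  have vab : v a < v b.
    rewrite /v /= -subr_gt0.
    move: ab; rewrite -(@ltr_pM2l _ (4 ^- k)) ?invr_gt0 ?exprn_gt0 // mulrA.
    by rewrite mulVf ?expf_neq0 ?pnatr_eq0 //; lra.
  (* v may jump up but decreases at rate at most 1. *)
  have vL x y : 0 <= x -> x <= y -> y <= 1 -> v x - (y - x) <= v y.
    move=> x0 xy y1; have : 4 ^- k * F x <= 4 ^- k * F y.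
      by apply: nd => //; rewrite in_itv /= ?x0 ?y1 ?(le_trans xy) ?(le_trans x0).
    by rewrite /v /=; lra.
  have [d [d0 dv da db]] : exists d, [/\ 0 < d, d <= (v b - v a) / 3,
      forall x, 0 <= x -> z - d < x -> a <= x
    & forall x, x <= 1 -> x < z + d -> x <= b].
    (* The default radius 1 is used only if a = z = 0, where a <= x holds for every x in [0,1];
       likewise for [db] at 1. *)
    pose da := if a < z then z - a else 1.
    pose db := if z < b then b - z else 1.
    exists (Num.min ((v b - v a) / 3) (Num.min da db)); split.
    + rewrite !lt_min /da /db; apply/and3P; split; first by lra.
        by case: ifP => // ?; lra.
      by case: ifP => // ?; lra.
    + by rewrite ge_min lexx.
    + move=> x x0; case: az' => [az1|z0]; last first.
        by move=> _; rewrite (le_trans az) // z0.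
      rewrite ltrBlDr -ltrBlDl !lt_min => /and3P[_ + _].
      by rewrite /da az1; lra.
    + move=> x x1; case: zb' => [zb1|z1]; last first.
        by move=> _; rewrite (le_trans _ zb) // z1.
      rewrite -ltrBlDl !lt_min => /and3P[_ _].
      by rewrite /db zb1; lra.
  suff [d' d'0 Hd'] : exists2 d', 0 < d' & forall x y, 0 <= x <= z -> z <= y <= 1 ->
      y - x < d' -> y - x <= (upper_envelope (fun y => 4 ^- k * F y) (fun y => y) y
       + lower_envelope (fun y => 4 ^- k * F y) (fun y => y) y)
       - (upper_envelope (fun y => 4 ^- k * F y) (fun y => y) x
       + lower_envelope (fun y => 4 ^- k * F y) (fun y => y) x).
    exists d' => // x y x0z zy1 yx; have := Hd' _ _ x0z zy1 yx.
    by rewrite /env; lra.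
  rewrite /upper_envelope /lower_envelope -/v.
  have z1 := le_trans zb b1; have z0 := le_trans a0 az.
  (* If v exceeds v a by d shortly before z, it cannot fall back below v a within distance d: all
     values near z are irrelevant to the infimum, and the lower envelope has slope 1 on both sides
     of z. *)
  have [[t [zt tz at_ vt]]|N1] :=
      pselect (exists t, [/\ z - d < t, t < z, a <= t & v a + d <= v t]).
    exists (Num.min (z - t) (t + d - z)).
      by rewrite lt_min; apply/andP; split; lra.
    move=> x y /andP[x0 xz] /andP[zy y1]; rewrite lt_min => /andP[xt yt].
    have xy := le_trans xz zy.
    have -> : inf_left v x = inf_left v y.
      apply: inf_left_const => // s /andP[xs sy].
      apply: (@le_trans _ _ (v a)).
        by apply: inf_left_le => //; rewrite ?a0 //=; lra.
      have := @vL t s (le_trans a0 at_) _ (le_trans sy y1); lra.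
    by have /andP[+ _] := upper_envelope_increment (nd k) idnd x0 xy y1;
      rewrite /upper_envelope -/v; lra.
  (* Symmetrically, if v is still below v b by d shortly after z, the upper envelope has slope 1 on
     both sides. *)
  have [[t [zt tz tb vt]]|N2] :=
      pselect (exists t, [/\ z < t, t < z + d, t <= b & v t <= v b - d]).
    exists (Num.min (t - z) (z - t + d)).
      by rewrite lt_min; apply/andP; split; lra.
    move=> x y /andP[x0 xz] /andP[zy y1]; rewrite lt_min => /andP[xt yt].
    have xy := le_trans xz zy.
    have -> : sup_right v x = sup_right v y.
      apply: sup_right_const => // s /andP[xs sy].
      apply: (@le_trans _ _ (v b)); last first.
        by apply: sup_right_ge => //; rewrite ?(le_trans z0) //= b1 andbT; lra.
      have := @vL s t (le_trans x0 xs) _ (le_trans tb b1); lra.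
    by have /andP[+ _] := lower_envelope_increment (nd k) idnd x0 xy y1;
      rewrite /lower_envelope -/v; lra.
  (* Otherwise v is below v a + d <= v b before z and above v b - d >= v a after z, so the chord
     [x, y] is split at z and each half uses its own envelope. *)
  exists d => // x y /andP[x0 xz] /andP[zy y1] yx.
  have -> : sup_right v x = sup_right v z.
    apply: sup_right_const => // s /andP[xs sz].
    apply: (@le_trans _ _ (v b)); last by apply: sup_right_ge; rewrite ?zb.
    rewrite leNgt; apply/negP => vs; apply: N1; exists s; split=> //.
    - by lra.
    - by apply: da; lra.
    - by lra.
  have <- : inf_left v z = inf_left v y.
    apply: inf_left_const => // s /andP[zs sy].
    apply: (@le_trans _ _ (v a)); first by apply: inf_left_le; rewrite ?a0.
    rewrite leNgt; apply/negP => vs; apply: N2; exists s; split=> //.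
    - by lra.
    - by apply: db; lra.
    - by lra.
  have /andP[+ _] := upper_envelope_increment (nd k) idnd z0 zy y1.
  have /andP[+ _] := lower_envelope_increment (nd k) idnd x0 xz z1.
  by rewrite /upper_envelope /lower_envelope -/v; lra.
Qed.

End steep_chords.

(** * Steep families from oscillating slopes *)

Section steep_oscillation.
Context (R : realType) (f : R -> R) (a : natfrac).
Hypothesis fnd : nondecreasing01 f.

Let al : R := fval R a.
Hypothesis al01 : 0 < al < 1.

(** The functions G k of the overview, with [al] for its a; [low k] is the intermediate L (a G
    k). *)
Fixpoint oscillation k : R -> R :=
  if k is k'.+1 then
    upper_envelope (lower_envelope (fun y => al * oscillation k' y) f) (fun y => y)
  else fun y => y.

Let low k := lower_envelope (fun y => al * oscillation k y) f.

Let nondecreasing_increment (h : R -> R) :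
  (forall x y, 0 <= x -> x <= y -> y <= 1 -> 0 <= h y - h x) ->
  nondecreasing01 h.
Proof.
move=> hi x y; rewrite !in_itv /= => /andP[x0 _] /andP[_ y1] xy.
by rewrite -subr_ge0 hi.
Qed.

Let al0 : 0 <= al. Proof. by case/andP: al01 => /ltW. Qed.
Let al1 : al <= 1. Proof. by case/andP: al01 => _ /ltW. Qed.

Let nd_scaled k : nondecreasing01 (oscillation k) ->
  nondecreasing01 (fun y => al * oscillation k y).
Proof. exact: nondecreasing01Z. Qed.

Let nd_low k : nondecreasing01 (oscillation k) -> nondecreasing01 (low k).
Proof.
move=> nd; apply: nondecreasing_increment => x y x0 xy y1.
by have /andP[] := lower_envelope_increment (nd_scaled nd) fnd x0 xy y1.
Qed.

Let nd_oscillation k : nondecreasing01 (oscillation k).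
Proof.
elim: k => [//|k IH]; apply: nondecreasing_increment => x y x0 xy y1.
by have /andP[] :=
  upper_envelope_increment (nd_low IH) (@nondecreasing01_id R) x0 xy y1.
Qed.

Lemma oscillation_increment k x y : 0 <= x -> x <= y -> y <= 1 ->
  0 <= oscillation k y - oscillation k x <= y - x.
Proof.
case: k => [|k] x0 xy y1; first by rewrite /= subr_ge0 xy lexx.
apply: upper_envelope_increment => //; exact: nd_low.
Qed.

(** Both envelopes stay within the range of the function they start from, so each round changes the
    bound only by the factor [al]. *)
Lemma oscillation_itv k x : 0 <= x <= 1 -> 0 <= oscillation k x <= al ^+ k.
Proof.
elim: k x => [//|k IH] x x01; have nd := nd_oscillation k.
have z01 : 0 <= (0 : R) <= 1 by rewrite lexx ler01.
have o01 : 0 <= (1 : R) <= 1 by rewrite lexx ler01.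
have := upper_envelope_itv (nd_low nd) (@nondecreasing01_id R) x01.
have := lower_envelope_itv (nd_scaled nd) fnd x01.
have := lower_envelope_itv (nd_scaled nd) fnd o01.
rewrite -/(low k) -/(oscillation k.+1).
move=> /andP[_ l1] /andP[lx _] /andP[ux u1]; apply/andP; split.
  by apply: le_trans ux; apply: le_trans lx; rewrite mulr_ge0 //; case/andP: (IH _ z01).
apply: (le_trans u1); apply: (le_trans l1).
by rewrite exprS ler_wpM2l //; case/andP: (IH _ o01).
Qed.

Variable z : R.
Hypothesis z01 : 0 < z < 1.
Hypothesis f_cont : forall e : R, 0 < e -> exists2 d, 0 < d &
  forall t, 0 <= t <= 1 -> `|t - z| < d -> `|f t - f z| < e.
Hypothesis low_left : forall d : R, 0 < d -> exists y,
  [/\ 0 <= y, z - d < y, y < z & f z - f y < al * (z - y)].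
Hypothesis high_right : forall d : R, 0 < d -> exists y,
  [/\ y <= 1, z < y, y < z + d & y - z < f y - f z].

(** If G k has slope 1 near z, a chord [y0, z] of f with slope below [al] makes v = al G k - f
    larger at z than at y0, and by continuity larger near z as well. The infimum then ignores the
    points near z, and [low k] moves there like f. A chord [z, y1] of f with slope above 1 in that
    region lifts w = [low k] - id, so the points near z lie in the shadow of y1 and G (k + 1) moves
    like the identity. *)
Lemma oscillation_slope k : exists2 d, 0 < d & forall x y,
  z - d < x -> x <= y -> y < z + d ->
  [/\ 0 <= x, y <= 1 & oscillation k y - oscillation k x = y - x].
Proof.
have /andP[z0 z1] := z01.
elim: k => [|k [d d0 IH]].
  exists (Num.min z (1 - z)); first by rewrite lt_min subr_gt0 z0.
  move=> x y; rewrite ltrBlDr -!ltrBlDl !lt_min => /andP[? ?] ? /andP[? ?].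
  by split=> //; lra.
have nd := nd_oscillation k.
pose v : R -> R := (fun y => al * oscillation k y) \- f.
have vB : bounded01 v.
  by apply: bounded01B; apply: nondecreasing01_bounded => //; exact: nd_scaled.
have [y0 [y00 zy0 y0z fy0]] := low_left d0.
pose e := v z - v y0.
have e0 : 0 < e.
  have [|_ _ E] := IH y0 z zy0 (ltW y0z); first by lra.
  by rewrite /e /v /= -(subrK (oscillation k y0) (oscillation k z)) E mulrDr; lra.
(* Half of the gap e is left for the variation of f, half for that of al G k, which is
   1-Lipschitz. *)
have [|d1 d10 f1] := f_cont (e := e / 2); first by lra.
pose d2 := Num.min (Num.min d d1) (Num.min (z - y0) (e / 2)).
have d20 : 0 < d2 by rewrite !lt_min d0 d10 subr_gt0 y0z /=; lra.
have near2 t : z - d2 < t -> t < z + d2 ->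
    [/\ z - d < t < z + d, `|t - z| < d1, y0 < t & `|t - z| < e / 2].
  rewrite ltrBlDr -!ltrBlDl !lt_min => /andP[/andP[? ?] /andP[? ?]].
  move=> /andP[/andP[? ?] /andP[? ?]]; rewrite !ltr_norml.
  by split; [apply/andP; split | apply/andP; split | | apply/andP; split]; lra.
clearbody d2.
have low_slope x y : z - d2 < x -> x <= y -> y < z + d2 ->
    low k y - low k x = f y - f x.
  move=> zx xy yz; have xz := le_lt_trans xy yz; have zy := lt_le_trans zx xy.
  have [/andP[zdx _] _ y0x _] := near2 _ zx xz.
  have [/andP[_ ydz] _ _ _] := near2 _ zy yz.
  have [x0 y1 _] := IH x y zdx xy ydz.
  suff E : inf_left v x = inf_left v y.
    by rewrite /low /lower_envelope -/v E; ring.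
  apply: inf_left_const => // t /andP[xt ty].
  apply: (@le_trans _ _ (v y0)).
    by apply: inf_left_le; rewrite ?y00 ?(le_trans xy) //= ltW.
  have [_ td1 _ te] := near2 _ (lt_trans zx xt) (le_lt_trans ty yz).
  have t01 : 0 <= t <= 1 by rewrite (le_trans ty y1) (le_trans x0 (ltW xt)).
  have := f1 t t01 td1; rewrite ltr_norml => /andP[_ ft].
  have H : oscillation k z - oscillation k t <= e / 2.
    move: te; rewrite ltr_norml => /andP[? ?]; have /andP[t0 t1] := t01.
    have [zt|/ltW tz] := leP z t.
      by have /andP[] := oscillation_increment k (ltW z0) zt t1; lra.
    by have /andP[] := oscillation_increment k t0 tz (ltW z1); lra.
  have H' : al * (oscillation k z - oscillation k t) <= e / 2.
    apply: le_trans (ler_wpM2l al0 H) _; rewrite ler_piMl //; lra.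
  suff : v z - v t <= e by rewrite /e; lra.
  by rewrite /v /=; move: ft H'; lra.
(* y1 is sought within d2, where [low k] already has the increments of f. *)
have [y1 [y11 zy1 y1d fy1]] := high_right d20.
pose w : R -> R := low k \- (fun y => y).
have wB : bounded01 w.
  by apply: bounded01B; apply: nondecreasing01_bounded => //; exact: nd_low.
pose h := w y1 - w z.
have h0 : 0 < h.
  have := low_slope z y1 _ (ltW zy1) y1d; rewrite /h /w /=; lra.
have [|d3 d30 f3] := f_cont (e := h / 2); first by lra.
pose d4 := Num.min (Num.min d2 d3) (Num.min (y1 - z) (h / 2)).
have d40 : 0 < d4 by rewrite !lt_min d20 d30 subr_gt0 zy1 /=; lra.
have near4 t : z - d4 < t -> t < z + d4 ->
    [/\ z - d2 < t, t < z + d2, `|t - z| < d3, t < y1 & `|t - z| < h / 2].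
  rewrite ltrBlDr -!ltrBlDl !lt_min => /andP[/andP[? ?] /andP[? ?]].
  move=> /andP[/andP[? ?] /andP[? ?]]; rewrite !ltr_norml.
  by split; [ | | apply/andP; split | | apply/andP; split]; lra.
exists d4 => // x y zx xy yz; have xz := le_lt_trans xy yz; have zy := lt_le_trans zx xy.
have [zx2 xz2 _ _ _] := near4 _ zx xz.
have [zy2 yz2 _ yy1 _] := near4 _ zy yz.
have [/andP[zdx _] _ _ _] := near2 _ zx2 xz2.
have [/andP[_ ydz] _ _ _] := near2 _ zy2 yz2.
have [x0 yle1 _] := IH x y zdx xy ydz; split=> //.
suff E : sup_right w x = sup_right w y.
  by rewrite /= /upper_envelope -/(low k) -/w E; ring.
apply: sup_right_const => // t /andP[xt ty].
apply: (@le_trans _ _ (w y1)); last first.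
  by apply: sup_right_ge; rewrite ?y11 ?(le_trans x0) //= ltW.
have zt := lt_le_trans zx xt; have tz := lt_trans ty yz.
have [zt2 tz2 td3 _ th] := near4 _ zt tz.
have t01 : 0 <= t <= 1 by rewrite (le_trans x0 xt) (le_trans (ltW ty)).
have := f3 t t01 td3; rewrite ltr_norml => /andP[_ ft].
suff : w t - w z <= h by rewrite /h; lra.
have E : low k t - low k z = f t - f z.
  have [zlt|/ltW tlz] := leP z t; first by apply: low_slope; lra.
  by have := low_slope t z zt2 tlz; lra.
by move: th; rewrite ltr_norml /w /= => /andP[? ?]; lra.
Qed.

(** At level n each envelope acts on tables of 2 ^ n + 1 grid values, so that k rounds are a
    recursion on lists. *)
Lemma dyadic_computable_oscillation :
  dyadic_computable (fun=> f) -> dyadic_computable oscillation.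
Proof.
move=> [q cq qf].
pose grid i n := frac_mul (frac_nat i) (frac_pow2V n).
pose lowtab n (T : seq natfrac) := mkseq (fun i => frac_add
  (frac_bigmin (fun l => frac_add (frac_mul a (nth a T l)) (frac_opp (q (0, n, l))))
    i) (q (0, n, i)))%N (2 ^ n).+1.
pose uptab n (T : seq natfrac) := mkseq (fun j => frac_add
  (frac_bigmax (fun i => frac_add (nth a T (j + i)) (frac_opp (grid (j + i) n)))
    (2 ^ n - j)) (grid j n))%N (2 ^ n).+1.
pose table n k := nat_rect (fun=> seq natfrac) (mkseq (fun j => grid j n) (2 ^ n).+1)
  (fun _ T => uptab n (lowtab n T)) k.
(* Errors add up instead of multiplying, as extrema do not amplify errors and al <= 1. A round costs
   4 * 2 ^- n: 3 for the lower envelope, which uses the grid once and f twice, and 1 for the grid in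
   the upper one. *)
apply: (@dyadic_computable_weaken _ _
  (fun p => nth a (table p.1.2 p.1.1) p.2) (fun k => 4 * k)%N).
- have cl : computable (fun p => lowtab p.1 p.2).
    by rewrite /lowtab; repeat comp_step.
  have cu : computable (fun p => uptab p.1 p.2).
    by rewrite /uptab /grid; repeat comp_step.
  rewrite /table /grid; repeat comp_step.
  apply: (comp_comp cu (f := fun p : nat * nat * nat * nat * seq natfrac =>
    (p.1.1.1.2, lowtab p.1.1.1.2 p.2))); repeat comp_step.
  by apply: (comp_comp cl (f := fun p : nat * nat * nat * nat * seq natfrac =>
    (p.1.1.1.2, p.2))); repeat comp_step.
- by repeat comp_step.
move=> k n j /=; elim: k j => [|k IH] j jn.
  by rewrite /= nth_mkseq // /grid fval_mul fval_nat fval_pow2V subrr normr0 mul0r.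
have p0 := pow2V_ge0 R n.
have -> : table n k.+1 = uptab n (lowtab n (table n k)) by [].
have nd := nd_oscillation k; have ndl := nd_low nd.
have mono h x y : nondecreasing01 h -> 0 <= x -> x <= y -> y <= 1 -> h x <= h y :> R.
  move=> hnd x0 xy y1; apply: hnd; rewrite // in_itv /=.
    by rewrite x0 (le_trans xy).
  by rewrite y1 (le_trans x0).
have gridE i : fval R (grid i n) = i%:R / 2 ^+ n.
  by rewrite /grid fval_mul fval_nat fval_pow2V.
have HL i : (i <= 2 ^ n)%N ->
    `|fval R (nth a (lowtab n (table n k)) i) - low k (i%:R / 2 ^+ n)|
      <= (4 * k + 3)%:R * 2 ^- n.
  move=> le; rewrite nth_mkseq // fval_add.
  pose v : R -> R := (fun y => al * oscillation k y) \- f.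
  have vB : bounded01 v.
    by apply: bounded01B; apply: nondecreasing01_bounded => //; exact: nd_scaled.
  have /andP[i0 i1] := dyadic_in01 R le.
  have Hv : `|fval R (frac_bigmin (fun l => frac_add
      (frac_mul a (nth a (table n k) l)) (frac_opp (q (0, n, l)%N))) i)
      - inf_left v (i%:R / 2 ^+ n)| <= 2 ^- n + (4 * k + 1)%:R * 2 ^- n.
    apply: grid_inf_left => //.
      move=> y y0 yi; have [l li /andP[yl ly]] := grid_upper y0 yi.
      have /andP[_ l1] := dyadic_in01 R (leq_trans li le).
      exists l => //; rewrite /v /=.
      have := mono _ _ _ fnd y0 yl l1.
      have /andP[H0 H] := oscillation_increment k y0 yl l1.
      suff : al * (oscillation k (l%:R / 2 ^+ n) - oscillation k y) <= 2 ^- n by lra.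
      apply: (@le_trans _ _ (oscillation k (l%:R / 2 ^+ n) - oscillation k y)).
        by rewrite ler_piMl.
      by move: H ly; lra.
    move=> l li; rewrite fval_add fval_opp fval_mul -/al /v /=.
    have ln := leq_trans li le.
    have := IH l ln; have := qf 0%N n l ln.
    set A := fval R (nth _ _ _); set B := oscillation k _.
    set C := fval R _; set D := f _ => H1 H2.
    rewrite [X in `|X|](_ : _ = al * (A - B) - (C - D)); last by ring.
    apply: le_trans (ler_normB _ _) _; rewrite normrM (ger0_norm al0).
    rewrite natrD mulrDl mul1r lerD //; apply: le_trans H2.
    by rewrite ler_piMl.
  have := qf 0%N n i le; rewrite /low /lower_envelope -/v.
  move: Hv; rewrite !natrD !mulrDl mul1r.
  rewrite !ler_norml => /andP[? ?] /andP[? ?].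
  by apply/andP; split; lra.
rewrite nth_mkseq // fval_add gridE.
pose w : R -> R := low k \- (fun y => y).
have wB : bounded01 w by apply: bounded01B; apply: nondecreasing01_bounded.
have /andP[j0 j1] := dyadic_in01 R jn.
have : `|fval R (frac_bigmax (fun i => frac_add
      (nth a (lowtab n (table n k)) (j + i)) (frac_opp (grid (j + i) n))) (2 ^ n - j))%N
      - sup_right w (j%:R / 2 ^+ n)| <= 2 ^- n + (4 * k + 3)%:R * 2 ^- n.
  apply: (grid_sup_right (s := fun i => frac_add
      (nth a (lowtab n (table n k)) i) (frac_opp (grid i n)))) => //.
    move=> y jy y1; have y0 := le_trans j0 jy.
    have [|i le /andP[yi iy]] := @grid_upper R n (2 ^ n) y y0.
      by rewrite natrX divff ?expf_neq0.
    have /andP[_ i1] := dyadic_in01 R le.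
    exists i.
      rewrite le andbT -(ler_nat R) -(@ler_pM2r _ (2 ^- n)) ?pow2V_gt0 //.
      exact: le_trans yi.
    by have := mono _ _ _ ndl y0 yi i1; rewrite /w /=; move: iy; lra.
  move=> i le; rewrite fval_add fval_opp gridE /w /=.
  rewrite [X in `|X|](_ : _ =
      fval R (nth a (lowtab n (table n k)) i) - low k (i%:R / 2 ^+ n)).
    exact: HL.
  by ring.
have -> : oscillation k.+1 (j%:R / 2 ^+ n) = sup_right w (j%:R / 2 ^+ n) + j%:R / 2 ^+ n.
  by [].
have -> : (4 * k.+1)%:R = (4 * k + 3)%:R + 1 :> R.
  by rewrite natr1 -addnS mulnS addnC.
rewrite [(_ + 1) * _]mulrDl mul1r.
by rewrite !ler_norml => /andP[? ?]; apply/andP; split; lra.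
Qed.

(** With al ^ N <= 1/4, every N-th function of the sequence satisfies the bound 4 ^- k. *)
Lemma steep_family_of_oscillation : dyadic_computable (fun=> f) ->
  exists H, steep_family H z.
Proof.
move=> fd; have /andP[z0 z1] := z01; have /andP[_ al1'] := al01.
have [N HN] : exists N, al ^+ N <= 4^-1.
  have h : `|al| < 1 by rewrite ger0_norm.
  have e0 : 0 < 4^-1 :> R by rewrite invr_gt0.
  have /cvgrPdist_le/(_ _ e0) : (fun n => al ^+ n : R) @ \oo --> (0 : R).
    exact: cvg_expr.
  move=> [N _ /(_ N (leqnn N))]; rewrite /= sub0r normrN ger0_norm ?exprn_ge0 //.
  by exists N.
exists (fun k => oscillation (N * k)); split.
- apply: (dyadic_computable_reindex (phi := fun k => (N * k)%N)).
    by repeat comp_step.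
  exact: dyadic_computable_oscillation.
- move=> k x x01; have /andP[-> le] := oscillation_itv (N * k) x01.
  rewrite (le_trans le) // exprM -exprVn lerXn2r ?nnegrE ?exprn_ge0 //.
- by move=> k x y; exact: oscillation_increment.
- move=> k; have [d d0 H] := oscillation_slope (N * k).
  exists d => // x y /andP[x0 xz] /andP[zy y1] yx.
  have [||_ _ ->] := H x y _ (le_trans xz zy); try lra.
Qed.

End steep_oscillation.

(** * Sources of steep families *)

Section steep_sources.
Context (R : realType).
Implicit Types (f g : R -> R) (z : R).

(** The function that steps from 0 to 1 just after z is computable on dyadic points, whose
    comparison with z is decidable, and chords across the jump are arbitrarily steep. *)
Lemma steep_family_dyadic n j : 0 <= (j%:R / 2 ^+ n : R) < 1 ->
  exists H, steep_family H (j%:R / 2 ^+ n : R).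
Proof.
set z := _ / _ => /andP[z0 z1].
have lt2 (b : bool) : 0 <= (b%:R : R) <= 1 by case: b; rewrite ?lexx ler01.
apply: (@steep_family_of_chords _ (fun x : R => ((z < x)%R)%:R : R) z).
- move=> x y _ _ xy; case: ltP => // zx.
  by rewrite (lt_le_trans zx xy).
- exists (fun p => frac_nat (if p.2 * 2 ^ n <= j * 2 ^ p.1.2 then 0 else 1))%N.
    by repeat comp_step.
  move=> k m i im /=.
  have -> : (z < i%:R / 2 ^+ m) = ~~ (i * 2 ^ n <= j * 2 ^ m)%N.
    rewrite /z ltr_pdivrMr ?exprn_gt0 // mulrAC ltr_pdivlMr ?exprn_gt0 //.
    by rewrite -!natrX -!natrM ltr_nat ltnNge.
  by rewrite fval_nat; case: leqP => _ /=; rewrite subrr normr0 pow2V_ge0.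
- by move=> x _; exact: lt2.
(* The chord rises by 1 over a length of at most 2e, and r * 2e <= |r| / (|r| + 1) < 1. *)
move=> r; pose e := Num.min (1 - z) (2 * (`|r| + 1))^-1.
have r0 : 0 < 2 * (`|r| + 1) by have := normr_ge0 r; lra.
have e0 : 0 < e by rewrite lt_min subr_gt0 z1 invr_gt0.
have ez : e <= 1 - z by rewrite ge_min lexx.
exists (Num.max 0 (z - e)), (z + e); split.
- by rewrite le_max lexx /= ge_max z0 gerBl ltW.
- by apply/andP; split; lra.
- move: z0; rewrite le_eqVlt => /predU1P[<-|z0]; [by right|left].
  by rewrite gt_max z0 gtrBl.
- by left; rewrite ltrDl.
- have -> : (z < z + e) = true by rewrite ltrDl.
  have -> : (z < Num.max 0 (z - e)) = false.
    by apply/negbTE; rewrite -leNgt ge_max z0 gerBl ltW.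
  set a := Num.max _ _; change (r * (z + e - a) < 1 - 0); rewrite subr0.
  have ae : z - e <= a by rewrite le_max lexx orbT.
  have az : a <= z by rewrite ge_max z0 gerBl ltW.
  have : `|r| * (z + e - a) <= `|r| * (2 * e) by rewrite ler_wpM2l //; lra.
  have : (`|r| + 1) * (2 * e) <= 1.
    rewrite mulrA [_ * 2]mulrC -ler_pdivlMl // mulr1.
    by rewrite /e ge_min lexx orbT.
  have : r * (z + e - a) <= `|r| * (z + e - a).
    by rewrite ler_wpM2r ?ler_norm //; lra.
  by lra.
Qed.

Lemma dyadic_computable_affine f (c d : natfrac) :
  dyadic_computable (fun=> f) ->
  dyadic_computable (fun _ x => fval R c * f x + fval R d).
Proof.
move=> [q cq qf]; pose E := (Num.truncn `|fval R c|).+1.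
apply: (@dyadic_computable_weaken _ _
  (fun p => frac_add (frac_mul c (q p)) d) (fun=> E)).
- by repeat comp_step.
- exact: comp_cst.
move=> k n j jn; rewrite /= fval_add fval_mul opprD addrACA subrr addr0 -mulrBr normrM.
rewrite ler_pM // ?qf //.
by have /andP[_ /ltW] := truncn_itv (normr_ge0 (fval R c)).
Qed.

Lemma natfrac_of_rat (q : rat) : exists x, fval R x = ratr q.
Proof.
have [d dE] := denqP q.
rewrite -[q]divq_num_den dE; case: (numq q) => n.
  by exists (n, 0, d)%N; rewrite /fval /= fmorph_div /= !ratr_int subr0.
exists (0, n.+1, d)%N.
by rewrite /fval /= fmorph_div /= !ratr_int sub0r NegzE mulrNz.
Qed.

Lemma natfrac_between (x y : R) : x < y -> exists q, x < fval R q < y.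
Proof.
move=> /rat_in_itvoo[q]; rewrite in_itv /= => xqy.
by have [p pE] := natfrac_of_rat q; exists p; rewrite pE.
Qed.

(* Affine changes of [f] do not matter, so its range may be taken to be [0, 1]. *)
Lemma steep_family_of_slopes f z : nondecreasing01 f ->
  dyadic_computable (fun=> f) ->
  (forall r : R, exists a b, [/\ 0 <= a <= z, z <= b <= 1, a < z \/ z = 0,
    z < b \/ z = 1 & r * (b - a) < f b - f a]) ->
  exists H, steep_family H z.
Proof.
move=> fnd fd fz.
(* f - c lies between 0 and f 1 - f 0 + 1 < B + 1, which explains the scaling by 1 / (B + 1). A
   rational c keeps the change computable. *)
have [|c /andP[c1 cf]] := @natfrac_between (f 0 - 1) (f 0); first by lra.
pose B := (Num.truncn `|f 1 - f 0|).+1.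
have fB : f 1 - f 0 < B%:R.
  by apply: le_lt_trans (ler_norm _) _; case/andP: (truncn_itv (normr_ge0 (f 1 - f 0))).
have B0 : 0 < B.+1%:R^-1 :> R by rewrite invr_gt0 ltr0n.
pose u : natfrac := (1, 0, B)%N.
have uE : fval R u = B.+1%:R^-1 by rewrite /fval /= subr0 mul1r.
pose F x := fval R u * f x + fval R (frac_mul u (frac_opp c)).
have FE x : F x = B.+1%:R^-1 * (f x - fval R c).
  by rewrite /F fval_mul fval_opp uE -mulrDr.
apply: (@steep_family_of_chords _ F z).
- by move=> x y x01 y01 xy; rewrite !FE ler_pM2l // lerD2r fnd.
- exact: dyadic_computable_affine.
- move=> x x01; have /andP[x0 x1] := x01.
  have := fnd 0 x; have := fnd x 1; rewrite !in_itv /= !lexx x01 ler01.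
  move=> /(_ isT isT x1) H1 /(_ isT isT x0) H2.
  rewrite FE; apply/andP; split; first by rewrite mulr_ge0 ?(ltW B0) //; lra.
  by rewrite mulrC ler_pdivrMr ?ltr0n // mul1r -natr1; lra.
move=> r; have [a [b [az zb az' zb' H]]] := fz (r * B.+1%:R).
exists a, b; split=> //; rewrite !FE -mulrBr opprD addrACA subrr addr0.
by rewrite [ltRHS]mulrC ltr_pdivlMr ?ltr0n // mulrAC.
Qed.

(** Reversing both axes preserves increments; subtracting from the bound 4 ^- k keeps the range. *)
Lemma steep_family_reflect (H : nat -> R -> R) z :
  steep_family H (1 - z) -> steep_family (fun k x => 4 ^- k - H k (1 - x)) z.
Proof.
move=> [[q cq qH] H01 HL Hz].
have r01 (x : R) : 0 <= x <= 1 -> 0 <= 1 - x <= 1.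
  by move=> /andP[? ?]; apply/andP; split; lra.
split.
- exists (fun p => frac_add (frac_pow2V (p.1.1 + p.1.1))
    (frac_opp (q (p.1, 2 ^ p.1.2 - p.2)%N))).
    by repeat comp_step.
  move=> k n j jn; rewrite fval_add fval_opp fval_pow2V /=.
  have -> : 2 ^- (k + k) = 4 ^- k :> R.
    by rewrite exprD -exprMn; congr (_ ^+ _)^-1; ring.
  rewrite opprD addrACA subrr add0r opprK addrC distrC.
  have := qH k n (2 ^ n - j)%N (leq_subr _ _).
  by rewrite natrB // natrX mulrBl divff ?expf_neq0.
- move=> k x /r01 /(H01 k) /andP[? ?]; apply/andP; split; lra.
- move=> k x y x0 xy y1.
  have /andP[? ?] : 0 <= H k (1 - x) - H k (1 - y) <= 1 - x - (1 - y).
    by apply: HL; lra.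
  by apply/andP; split; lra.
- move=> k; have [d d0 Hd] := Hz k; exists d => // x y /andP[x0 xz] /andP[zy y1] yx.
  have := Hd (1 - y) (1 - x); rewrite !subr_ge0 y1 !lerD2l !lerN2 zy xz gerBl x0.
  move=> /(_ isT isT).
  by have -> : 1 - x - (1 - y) = y - x by [ring|]; move=> /(_ yx); lra.
Qed.

Definition continuous01_at f z := forall e : R, 0 < e -> exists2 d, 0 < d &
  forall t, 0 <= t <= 1 -> `|t - z| < d -> `|f t - f z| < e.

Lemma computable_fun01_continuous f z : 0 <= z <= 1 -> computable_fun01 f ->
  continuous01_at f z.
Proof.
move=> z01 [_ [h [_ hf]]] e e0.
have [N _ /(_ N (leqnn N)) /= Ne] := near_pow2V_le e0.
exists (2 ^- h N) => [|t t01 tz]; first exact: pow2V_gt0.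
exact: lt_le_trans (hf N t z t01 z01 tz) Ne.
Qed.

Definition frequently_left z (P : R -> Prop) := forall d : R, 0 < d ->
  exists y, [/\ 0 <= y, z - d < y, y < z & P y].

Definition frequently_right z (P : R -> Prop) := forall d : R, 0 < d ->
  exists y, [/\ y <= 1, z < y, y < z + d & P y].

(** For rationals c < b < g < C, division of f by g turns slopes above C into slopes above 1, and
    slopes below c into slopes below b / g < 1, which becomes the parameter [a] of the
    oscillation. *)
Lemma steep_family_left_right f z (c C : R) : nondecreasing01 f ->
  dyadic_computable (fun=> f) -> continuous01_at f z -> 0 < z < 1 ->
  0 < c < C ->
  frequently_left z (fun y => f z - f y < c * (z - y)) ->
  frequently_right z (fun y => C * (y - z) < f y - f z) ->
  exists H, steep_family H z.
Proof.
move=> fnd fd fcont z01 /andP[c0 cC] low high.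
have [g /andP[cg gC]] : exists g : rat, c < ratr g < C.
  by have [g] := rat_in_itvoo cC; rewrite in_itv; exists g.
have [b /andP[cb bg]] : exists b : rat, c < ratr b < (ratr g : R).
  by have [b] := rat_in_itvoo cg; rewrite in_itv; exists b.
have g0 := lt_trans c0 cg; have b0 := lt_trans c0 cb.
have [u uE] := natfrac_of_rat g^-1; rewrite fmorphV in uE.
have [a aE] := natfrac_of_rat (b / g); rewrite fmorph_div in aE.
have gV : 0 < (ratr g)^-1 :> R by rewrite invr_gt0.
apply: (@steep_family_of_oscillation _ (fun x => fval R u * f x + fval R (frac_nat 0)) a).
- by rewrite uE => x y x01 y01 xy; rewrite lerD2r ler_pM2l // fnd.
- by rewrite aE divr_gt0 //= ltr_pdivrMr // mul1r.
- exact: z01.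
- move=> e e0; have [d d0 Hd] := fcont (e * ratr g) (mulr_gt0 e0 g0).
  exists d => // t t01 /(Hd t t01) H.
  rewrite uE opprD addrACA subrr addr0 -mulrBr normrM gtr0_norm // mulrC.
  by rewrite ltr_pdivrMr.
- move=> d /low[y [y0 zdy yz H]]; exists y; split=> //.
  rewrite uE aE opprD addrACA subrr addr0 -mulrBr mulrC ltr_pdivrMr //.
  rewrite mulrAC divfK ?gt_eqF //; apply: lt_trans H _.
  by rewrite ltr_pM2r ?subr_gt0.
- move=> d /high[y [y1 zy yd H]]; exists y; split=> //.
  rewrite uE opprD addrACA subrr addr0 -mulrBr [ltRHS]mulrC ltr_pdivlMr //.
  by apply: lt_trans H; rewrite mulrC ltr_pM2r ?subr_gt0.
- exact: dyadic_computable_affine.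
Qed.

(** The graph of f is reflected through a point, which exchanges the two sides of z and keeps
    slopes. *)
Lemma steep_family_right_left f z (c C : R) : nondecreasing01 f ->
  dyadic_computable (fun=> f) -> continuous01_at f z -> 0 < z < 1 ->
  0 < c < C ->
  frequently_right z (fun y => f y - f z < c * (y - z)) ->
  frequently_left z (fun y => C * (z - y) < f z - f y) ->
  exists H, steep_family H z.
Proof.
move=> fnd [q cq qf] fcont /andP[z0 z1] cC low high.
suff [H HH] : exists H, steep_family H (1 - z).
  by exists (fun k x => 4 ^- k - H k (1 - x)); exact: steep_family_reflect.
pose f' x := - f (1 - x).
have r01 (x : R) : 0 <= x <= 1 -> 0 <= 1 - x <= 1.
  by move=> /andP[? ?]; apply/andP; split; lra.
have zE : 1 - (1 - z) = z by ring.
apply: (@steep_family_left_right f' _ c C) => //.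
- move=> x y; rewrite !in_itv /= => x01 y01 xy; rewrite lerN2.
  by apply: fnd; rewrite ?in_itv /= ?r01 // lerD2l lerN2.
- exists (fun p => frac_opp (q (p.1, 2 ^ p.1.2 - p.2)%N)); first by repeat comp_step.
  move=> k n j jn; rewrite fval_opp /f' /=.
  rewrite -opprB normrN opprK addrC.
  have := qf k n (2 ^ n - j)%N (leq_subr _ _).
  by rewrite natrB // natrX mulrBl divff ?expf_neq0.
- move=> e /fcont[d d0 Hd]; exists d => // t t01 td; rewrite /f' zE.
  rewrite -opprD normrN; apply: Hd; first exact: r01.
  by rewrite -normrN; move: td; congr (`|_| < _); ring.
- by apply/andP; split; lra.
- move=> d /low[y [y1 zy yd H]]; exists (1 - y); rewrite /f' zE.
  have -> : 1 - (1 - y) = y by ring.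
  by split; lra.
- move=> d /high[y [y0 zdy yz H]]; exists (1 - y); rewrite /f' zE.
  have -> : 1 - (1 - y) = y by ring.
  by split; lra.
Qed.

(** A steep chord that ends at z is prolonged a little beyond z. As f does not decrease there, the
    rise is kept and the slope drops only slightly. *)
Lemma steep_family_unbounded_slope f z : nondecreasing01 f ->
  dyadic_computable (fun=> f) -> 0 <= z <= 1 ->
  (forall r, exists y, [/\ 0 <= y <= 1, y != z & r < slope f z y]) ->
  exists H, steep_family H z.
Proof.
move=> fnd fd z01 fz; have /andP[z0 z1] := z01.
apply: (steep_family_of_slopes fnd fd) => r.
have [y [y01 yz]] := fz (`|r|); have /andP[y0 y1] := y01.
have r0 := normr_ge0 r; have := ler_norm r; move: `|r| r0 => s s0 rs.
have s1 : 0 < s + 1 by lra.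
rewrite /slope; have [{}yz|zy|E] := ltgtP y z; last by rewrite E eqxx in yz.
  rewrite ltr_pdivlMr ?subr_gt0 // => H.
  (* The numerator is the excess of the rise over slope s; (s + 1) e equals it, so a prolongation by
     e costs s e, less than the excess. *)
  pose e := (f z - f y - s * (z - y)) / (s + 1).
  have e0 : 0 < e by rewrite divr_gt0 // subr_gt0.
  exists y, (Num.min 1 (z + e)).
  have le1 : Num.min 1 (z + e) <= z + e by rewrite ge_min lexx orbT.
  have le2 : z <= Num.min 1 (z + e) by rewrite le_min z1 lerDl ltW.
  split=> //.
  - by rewrite y0 ltW.
  - by rewrite le2 ge_min lexx.
  - by left.
  - move: z1; rewrite le_eqVlt => /predU1P[->|z1]; [by right|left].
    by rewrite lt_min z1 ltrDl.
  set b := Num.min _ _ in le1 le2 *.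
  have fb : f z <= f b.
    by apply: fnd; rewrite ?in_itv //= /b ge_min lexx (le_trans z0).
  have : r * (b - y) <= s * (b - y) by rewrite ler_wpM2r //; lra.
  have : s * (b - z) <= s * e by rewrite ler_wpM2l //; lra.
  have : e * (s + 1) = f z - f y - s * (z - y) by rewrite divfK // gt_eqF.
  lra.
rewrite -[X in _ < X]mulrNN -invrN !opprB ltr_pdivlMr ?subr_gt0 // => H.
pose e := (f y - f z - s * (y - z)) / (s + 1).
have e0 : 0 < e by rewrite divr_gt0 // subr_gt0.
exists (Num.max 0 (z - e)), y.
have le1 : z - e <= Num.max 0 (z - e) by rewrite le_max lexx orbT.
have le2 : Num.max 0 (z - e) <= z by rewrite ge_max z0 gerBl ltW.
split=> //.
- by rewrite le2 le_max lexx.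
- by rewrite y1 ltW.
- move: z0; rewrite le_eqVlt => /predU1P[<-|z0]; [by right|left].
  by rewrite gt_max z0 gtrBl.
- by left.
set b := Num.max _ _ in le1 le2 *.
have fb : f b <= f z.
  by apply: fnd; rewrite ?in_itv //= /b le_max lexx (le_trans _ z1).
have : r * (y - b) <= s * (y - b) by rewrite ler_wpM2r //; lra.
have : s * (z - b) <= s * e by rewrite ler_wpM2l //; lra.
have : e * (s + 1) = f y - f z - s * (y - z) by rewrite divfK // gt_eqF.
lra.
Qed.

(** The values of M along Z are the slopes of its distribution function on the dyadic intervals of
    the expansion, and a nondyadic z is interior to them. *)
Lemma steep_family_of_martingale (M : seq bool -> R) Z z :
  martingale M -> computable_on_strings M -> binary_expansion Z z ->
  (forall n j, z != j%:R / 2 ^+ n) -> succeeds_on M Z ->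
  exists H, steep_family H z.
Proof.
move=> mM cM Zz zn suc.
have [F [Fnd Fd _ FM]] := martingale_cdf mM cM.
apply: (steep_family_of_slopes Fnd Fd) => r.
have [n Hn] : exists n, r < M (mkseq Z n).
  apply/not_existsP => N; apply: suc; exists r => _ [n _ <-].
  by rewrite leNgt; apply/negP => /N.
have := FM (mkseq Z n); rewrite size_mkseq.
have /andP[zj jz] := binary_expansion_itv n Zz.
have lt := string_val_lt (mkseq Z n); rewrite size_mkseq in lt.
have /andP[j0 _] := dyadic_in01 R (ltnW lt).
have /andP[_ j1] := dyadic_in01 R lt.
set j := string_val (mkseq Z n) => E.
exists (j%:R / 2 ^+ n), (j.+1%:R / 2 ^+ n); split.
- by rewrite j0 zj.
- by rewrite j1 jz.
- by left; rewrite lt_neqAle zj eq_sym zn.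
- by left; rewrite lt_neqAle jz zn.
- rewrite E -mulrBl -natr1 addrAC subrr add0r mul1r.
  by rewrite ltr_pM2r ?invr_gt0 ?exprn_gt0.
Qed.

End steep_sources.

(** * Derivatives on the unit interval *)

Section derivatives.
Context (R : realType).
Implicit Types (f g : R -> R) (z : R).

Let punctured z (d : R) : set R :=
  [set h | [/\ `|h| < d, h != 0 & 0 <= z + h <= 1]].

Lemma increments01_near z (d : R) : 0 < d ->
  increments01 z (punctured z d).
Proof.
move=> d0; rewrite /increments01 /within /=.
apply/(nbhs_ballP (0 : R)); exists d => //= h; rewrite /ball /= sub0r normrN.
by move=> hd h0 zh; split.
Qed.

Lemma increments01_proper z (V : set R) : 0 <= z < 1 -> increments01 z V ->
  exists h, [/\ V h, h != 0 & 0 <= z + h <= 1].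
Proof.
move=> /andP[z0 z1]; rewrite /increments01 /within /= => /(nbhs_ballP (0 : R)).
move=> [d /= d0 Hd]; pose h := Num.min (d / 2) (1 - z).
have h0 : 0 < h by rewrite lt_min subr_gt0 z1 divr_gt0.
have hd : h <= d / 2 by rewrite ge_min lexx.
have hz : h <= 1 - z by rewrite ge_min lexx orbT.
exists h; have hn : h != 0 by rewrite gt_eqF.
have zh : 0 <= z + h <= 1 by apply/andP; split; lra.
split=> //; apply: Hd => //; rewrite /ball /= sub0r normrN gtr0_norm //.
lra.
Qed.

Lemma upper_derivative_gt f z (C : R) : (C%:E < upper_derivative f z)%E ->
  forall d : R, 0 < d -> exists y,
    [/\ 0 <= y <= 1, y != z, `|y - z| < d & C < slope f z y].
Proof.
rewrite /upper_derivative /limf_esup => CU d d0.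
have : (C%:E < ereal_sup ((fun h => (slope f z (z + h))%:E) @` punctured z d))%E.
  apply: lt_le_trans CU _; apply: ereal_inf_lbound.
  by eexists; [exact: (increments01_near z d0)|].
move=> /ereal_sup_gt[_ [h [hd h0 zh] <-]]; rewrite lte_fin => H.
exists (z + h); split=> //.
  by rewrite -subr_eq0 addrAC subrr add0r.
by rewrite addrAC subrr add0r.
Qed.

Lemma lower_derivative_lt f z (c : R) : (lower_derivative f z < c%:E)%E ->
  forall d : R, 0 < d -> exists y,
    [/\ 0 <= y <= 1, y != z, `|y - z| < d & slope f z y < c].
Proof.
rewrite /lower_derivative limf_einfE => LC d d0.
have : (ereal_inf ((fun h => (slope f z (z + h))%:E) @` punctured z d) < c%:E)%E.
  apply: le_lt_trans LC; apply: ereal_sup_ubound.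
  by eexists; [exact: (increments01_near z d0)|].
move=> /ereal_inf_lt[_ [h [hd h0 zh] <-]]; rewrite lte_fin => H.
exists (z + h); split=> //.
  by rewrite -subr_eq0 addrAC subrr add0r.
by rewrite addrAC subrr add0r.
Qed.

Lemma lower_le_upper_derivative f z : 0 <= z < 1 ->
  (lower_derivative f z <= upper_derivative f z)%E.
Proof.
move=> z01; rewrite /lower_derivative limf_einfE.
apply: ge_ereal_sup => _ [V FV <-]; apply: le_ereal_inf_tmp => _ [W FW <-].
have [h [[Vh Wh] _ _]] : exists h, [/\ (V `&` W) h, h != 0 & 0 <= z + h <= 1].
  by apply: increments01_proper => //; exact: filterI.
apply: (@le_trans _ _ (slope f z (z + h))%:E).
  by apply: ereal_inf_lbound; exists h.
by apply: ereal_sup_ubound; exists h.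
Qed.

Lemma slope_ge0 f z y : nondecreasing01 f -> 0 <= z <= 1 -> 0 <= y <= 1 ->
  0 <= slope f z y.
Proof.
move=> fnd z01 y01; rewrite /slope; have [zy|/ltW yz] := leP z y.
  by rewrite -mulrNN -invrN !opprB divr_ge0 // subr_ge0 // fnd ?in_itv.
by rewrite divr_ge0 // subr_ge0 // fnd ?in_itv.
Qed.

Lemma lower_derivative_ge f z (K d : R) : 0 < d ->
  (forall y, 0 <= y <= 1 -> y != z -> `|y - z| < d -> K <= slope f z y) ->
  (K%:E <= lower_derivative f z)%E.
Proof.
move=> d0 H; rewrite /lower_derivative limf_einfE.
apply: le_ereal_sup_tmp.
exists (ereal_inf ((fun h => (slope f z (z + h))%:E) @` punctured z d)).
  by eexists; [exact: (increments01_near z d0)|].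
apply: le_ereal_inf_tmp => _ [h [hd h0 zh] <-]; rewrite lee_fin.
apply: H => //; first by rewrite -subr_eq0 addrAC subrr add0r.
by rewrite addrAC subrr add0r.
Qed.

Lemma steep_at_lower_derivative g z : 0 <= z <= 1 -> steep_at g z ->
  lower_derivative g z = +oo%E.
Proof.
move=> z01 st; have /andP[z0 z1] := z01; apply/eqyP => K _.
have [d d0 Hd] := st K; apply: (lower_derivative_ge d0) => y y01 yz yd.
have /andP[y0 y1] := y01.
rewrite /slope; have [{}yz|zy|E] := ltgtP y z; last by rewrite E eqxx in yz.
  rewrite ler_pdivlMr ?subr_gt0 //; apply: Hd; rewrite ?lexx ?y0 ?z1 ?ltW //.
  by move: yd; rewrite distrC ger0_norm // subr_ge0 ltW.
rewrite -[leRHS]mulrNN -invrN !opprB ler_pdivlMr ?subr_gt0 //.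
apply: Hd; rewrite ?lexx ?z0 ?y1 ?ltW //.
by move: yd; rewrite ger0_norm // subr_ge0 ltW.
Qed.

Lemma frequently_left_or_right z (P : R -> Prop) :
  (forall d : R, 0 < d -> exists y, [/\ 0 <= y <= 1, y != z, `|y - z| < d & P y]) ->
  frequently_left z P \/ frequently_right z P.
Proof.
move=> H; have [?|NL] := pselect (frequently_left z P); [by left|right].
move: NL => /existsNP[d /not_implyP[d0 Nd]] e e0.
have m0 : 0 < Num.min d e by rewrite lt_min d0.
have [y [/andP[y0 y1] yz]] := H _ m0; rewrite lt_min !ltr_norml.
move=> /andP[/andP[? ?] /andP[? ?]] Py.
have [yz'|zy|E] := ltgtP y z; last by rewrite E eqxx in yz.
  by exfalso; apply: Nd; exists y; split=> //; lra.
by exists y; split=> //; lra.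
Qed.

Lemma not_frequently_left z (P : R -> Prop) : ~ frequently_left z P ->
  exists2 d, 0 < d & forall y, 0 <= y -> z - d < y -> y < z -> ~ P y.
Proof.
move=> /existsNP[d /not_implyP[d0 Nd]]; exists d => // y y0 zy yz Py.
by apply: Nd; exists y.
Qed.

Lemma not_frequently_right z (P : R -> Prop) : ~ frequently_right z P ->
  exists2 d, 0 < d & forall y, y <= 1 -> z < y -> y < z + d -> ~ P y.
Proof.
move=> /existsNP[d /not_implyP[d0 Nd]]; exists d => // y y1 zy yz Py.
by apply: Nd; exists y.
Qed.

Lemma slope_left f z y (c : R) : y < z ->
  (slope f z y < c) = (f z - f y < c * (z - y)) /\
  (c < slope f z y) = (c * (z - y) < f z - f y).
Proof.
by move=> yz; rewrite /slope ltr_pdivrMr ?ltr_pdivlMr ?subr_gt0.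
Qed.

Lemma slope_right f z y (c : R) : z < y ->
  (slope f z y < c) = (f y - f z < c * (y - z)) /\
  (c < slope f z y) = (c * (y - z) < f y - f z).
Proof.
move=> zy; have -> : slope f z y = (f y - f z) / (y - z).
  by rewrite /slope -mulrNN -invrN !opprB.
by rewrite ltr_pdivrMr ?ltr_pdivlMr ?subr_gt0.
Qed.

Lemma frequently_leftW z (P Q : R -> Prop) : (forall y, y < z -> P y -> Q y) ->
  frequently_left z P -> frequently_left z Q.
Proof. by move=> PQ H d /H[y [? ? ? /PQ]]; exists y; split=> //; auto. Qed.

Lemma frequently_rightW z (P Q : R -> Prop) : (forall y, z < y -> P y -> Q y) ->
  frequently_right z P -> frequently_right z Q.
Proof. by move=> PQ H d /H[y [? ? ? /PQ]]; exists y; split=> //; auto. Qed.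

End derivatives.

(** * Failure of differentiability and binary expansions *)

Section main.
Context (R : realType).
Implicit Types (f g : R -> R) (z : R).

(** With a finite upper derivative, constants lower < c < c2 < m < C < upper are fixed. Suppose that
    slopes above C occur on the left of z. If slopes below m occur on the right, m and C are the two
    levels. Otherwise the slopes on the right are eventually at least m > c2, so slopes below c must
    occur on the left, and the levels are c and c2 with the sides exchanged. The other side is
    symmetric. *)
Lemma steep_family_of_not_differentiable f z : computable_fun01 f ->
  nondecreasing01 f -> 0 <= z < 1 -> ~ differentiable01 f z ->
  exists H, steep_family H z.
Proof.
move=> cf fnd z01 ndiff; have /andP[z0 z1] := z01.
have zle : 0 <= z <= 1 by rewrite z0 ltW.
have [zE|zn0] := eqVneq z 0.
  have zE' : z = 0%:R / 2 ^+ 0 by rewrite mul0r.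
  by rewrite zE'; apply: steep_family_dyadic; rewrite -zE'.
have zoo : 0 < z < 1 by rewrite z1 lt_def zn0 z0.
have fd := computable_fun01_dyadic cf.
have fcont := computable_fun01_continuous zle cf.
have [Uoo|Uoo] := eqVneq (upper_derivative f z) +oo%E.
  apply: (steep_family_unbounded_slope fnd fd zle) => r.
  have [|y [y01 yz _ H]] := @upper_derivative_gt _ f z r _ 1 ltr01.
    by rewrite Uoo ltry.
  by exists y.
have L0 : (0%:E <= lower_derivative f z)%E.
  by apply: (lower_derivative_ge ltr01) => y y01 _ _; exact: slope_ge0.
have LU := lower_le_upper_derivative f z01.
have Ufin : upper_derivative f z \is a fin_num.
  by rewrite fin_numE Uoo andbT gt_eqF // (lt_le_trans _ (le_trans L0 LU)) // ltNyr.
have {}LU : (lower_derivative f z < upper_derivative f z)%E.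
  by rewrite lt_neqAle LU andbT; apply/eqP => E; apply: ndiff; split.
have Lfin : lower_derivative f z \is a fin_num.
  by rewrite ge0_fin_numE // (lt_le_trans LU) // leey.
move: L0 LU (@upper_derivative_gt _ f z) (@lower_derivative_lt _ f z).
rewrite -(fineK Ufin) -(fineK Lfin) lee_fin lte_fin.
move: (fine _) (fine _) => u l l0 lu HU HL.
have [c [c2 [m [C [lc cc2 c2m mC Cu]]]]] : exists c c2 m C,
    [/\ l < c, c < c2, c2 < m, m < C & C < u].
  exists (l + (u - l) / 5), (l + (u - l) / 5 * 2), (l + (u - l) / 5 * 3),
    (l + (u - l) / 5 * 4).
  by split; lra.
have c0 : 0 < c by lra.
have low d : 0 < d -> exists y : R,
    [/\ 0 <= y <= 1, y != z, `|y - z| < d & slope f z y < c].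
  by apply: HL; rewrite lte_fin.
have high d : 0 < d -> exists y : R,
    [/\ 0 <= y <= 1, y != z, `|y - z| < d & C < slope f z y].
  by apply: HU; rewrite lte_fin.
have lr k K : 0 < k < K -> frequently_left z (fun y => slope f z y < k) ->
    frequently_right z (fun y => K < slope f z y) -> exists H, steep_family H z.
  move=> kK L H; apply: (steep_family_left_right fnd fd fcont zoo kK).
    by apply: frequently_leftW L => y yz; rewrite (slope_left _ _ yz).1.
  by apply: frequently_rightW H => y yz; rewrite (slope_right _ _ yz).2.
have rl k K : 0 < k < K -> frequently_right z (fun y => slope f z y < k) ->
    frequently_left z (fun y => K < slope f z y) -> exists H, steep_family H z.
  move=> kK L H; apply: (steep_family_right_left fnd fd fcont zoo kK).
    by apply: frequently_rightW L => y yz; rewrite (slope_right _ _ yz).1.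
  by apply: frequently_leftW H => y yz; rewrite (slope_left _ _ yz).2.
have [hl|hr] := frequently_left_or_right high.
  have [lowr|Nlowr] := pselect (frequently_right z (fun y => slope f z y < m)).
    by apply: (rl m C) => //; apply/andP; split; lra.
  have [d d0 Hd] := not_frequently_right Nlowr.
  apply: (lr c c2); first by apply/andP; split; lra.
    have [//|lowr] := frequently_left_or_right low.
    by case: Nlowr; apply: frequently_rightW lowr => y _; lra.
  (* Every point close enough to z on the right has slope at least m, so any one of them in [0,1]
     will do. *)
  move=> e e0; pose y := z + Num.min (1 - z) (Num.min d e / 2).
  have m0 : 0 < Num.min d e by rewrite lt_min d0.
  have le1 : Num.min d e <= d by rewrite ge_min lexx.
  have le2 : Num.min d e <= e by rewrite ge_min lexx orbT.
  have le3 : Num.min (1 - z) (Num.min d e / 2) <= Num.min d e / 2.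
    by rewrite ge_min lexx orbT.
  have le4 : Num.min (1 - z) (Num.min d e / 2) <= 1 - z by rewrite ge_min lexx.
  have gt0 : 0 < Num.min (1 - z) (Num.min d e / 2).
    by rewrite lt_min subr_gt0 z1 divr_gt0.
  exists y; have zy : z < y by rewrite ltrDl.
  have y1 : y <= 1 by rewrite /y; lra.
  split=> //; first by rewrite /y; lra.
  have := Hd y y1 zy; rewrite ltNge => H; apply: lt_le_trans c2m _.
  by apply/negPn/negP => /negP N; apply: H => //; rewrite /y; lra.
have [lowl|Nlowl] := pselect (frequently_left z (fun y => slope f z y < m)).
  by apply: (lr m C) => //; apply/andP; split; lra.
have [d d0 Hd] := not_frequently_left Nlowl.
apply: (rl c c2); first by apply/andP; split; lra.
  have [lowl|//] := frequently_left_or_right low.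
  by case: Nlowl; apply: frequently_leftW lowl => y _; lra.
move=> e e0; pose y := z - Num.min z (Num.min d e / 2).
have zp : 0 < z by case/andP: zoo.
have m0 : 0 < Num.min d e by rewrite lt_min d0.
have le1 : Num.min d e <= d by rewrite ge_min lexx.
have le2 : Num.min d e <= e by rewrite ge_min lexx orbT.
have le3 : Num.min z (Num.min d e / 2) <= Num.min d e / 2.
  by rewrite ge_min lexx orbT.
have le4 : Num.min z (Num.min d e / 2) <= z by rewrite ge_min lexx.
have gt0 : 0 < Num.min z (Num.min d e / 2).
  by rewrite lt_min zp divr_gt0.
exists y; have yz : y < z by rewrite gtrBl.
have y0 : 0 <= y by rewrite /y; lra.
split=> //; first by rewrite /y; lra.
apply: lt_le_trans c2m _; rewrite leNgt; apply/negP.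
by apply: Hd => //; rewrite /y; lra.
Qed.

Lemma binary_expansion_exists z : 0 <= z < 1 -> exists Z, binary_expansion Z z.
Proof.
move=> /andP[z0 z1]; pose t n := Num.truncn (z * 2 ^+ n).
have tP n : (t n)%:R <= z * 2 ^+ n < (t n).+1%:R.
  by apply: truncn_itv; rewrite mulr_ge0 ?exprn_ge0.
pose Z n := odd (t n.+1).
have tS n : t n.+1 = ((t n).*2 + Z n)%N.
  rewrite addnC /Z -[LHS](odd_double_half (t n.+1)); congr (_ + _.*2)%N.
  have /andP[a b] := tP n; have /andP[] := tP n.+1.
  rewrite exprS mulrCA => c d.
  apply/eqP; rewrite eqn_leq; apply/andP; split.
    rewrite -ltnS ltn_half_double -(ltr_nat R) -mul2n natrM.
    by apply: le_lt_trans c _; rewrite ltr_pM2l.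
  rewrite geq_half_double -ltnS -(ltr_nat R) -mul2n natrM.
  by apply: le_lt_trans d; rewrite ler_pM2l.
have uE n : series (fun i => (Z i)%:R / 2 ^+ i.+1 : R) n = (t n)%:R / 2 ^+ n.
  elim: n => [|n IH].
    rewrite /series /= big_geq //; have /andP[+ _] := tP 0%N.
    rewrite expr0 mulr1 divr1 => /le_lt_trans /(_ z1).
    by rewrite (ltr_nat _ _ 1) ltnS leqn0 => /eqP ->.
  rewrite seriesSr IH tS natrD -mul2n natrM exprS; field.
  by rewrite expf_neq0.
exists Z; split.
  apply/cvgrPdist_le => e /near_pow2V_le; apply: filterS => n le.
  rewrite uE; apply: le_trans le; have /andP[a b] := tP n.
  rewrite -ler_pdivrMr ?exprn_gt0 // in a.
  rewrite ger0_norm ?subr_ge0 // lerBlDl -[X in _ + X]mul1r -mulrDl natr1.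
  by rewrite ler_pdivlMr ?exprn_gt0 // ltW.
move=> n; apply: contrapT => N.
have Z1 m : (n <= m)%N -> Z m = true.
  by move=> nm; apply/negPn/negP => /negbTE E; apply: N; exists m.
(* With only digits 1 from n on, z 2 ^ n comes within 2 ^- m of [(t n).+1] for every m, although
   truncation keeps it a fixed distance below. *)
have tn m : ((t (n + m)%N).+1 = (t n).+1 * 2 ^ m)%N.
  elim: m => [|m IH]; first by rewrite addn0 muln1.
  by rewrite addnS tS Z1 ?leq_addr // addn1 -doubleS IH expnS mulnCA mul2n.
have /andP[_ lt] := tP n.
have p0 : 0 < (2 : R) ^+ n by rewrite exprn_gt0.
have e0 : 0 < (t n).+1%:R - z * 2 ^+ n by rewrite subr_gt0.
have e20 : 0 < ((t n).+1%:R - z * 2 ^+ n) / 2 by rewrite divr_gt0.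
have [m _ /(_ m (leqnn m)) /= le] := near_pow2V_le e20.
have /andP[+ _] := tP (n + m)%N; rewrite -(lerD2r 1) natr1 tn natrM natrX exprD mulrA.
rewrite -lerBlDl -mulrBl -ler_pdivlMr ?exprn_gt0 // mul1r.
by move: le e0; lra.
Qed.

End main.

Theorem theorem4p1 (R : realType) (z : R) (hz : 0 <= z < 1) :
  [<-> computably_random z;
       forall f : R -> R,
         computable_fun01 f -> nondecreasing01 f -> differentiable01 f z;
       forall g : R -> R,
         computable_fun01 g -> nondecreasing01 g ->
         (upper_derivative g z < +oo)%E;
       forall g : R -> R,
         computable_fun01 g -> nondecreasing01 g ->
         (lower_derivative g z < +oo)%E].
Proof.
have zle : 0 <= z <= 1 by case/andP: hz => -> /ltW.
split=> [[Z Zz Zr] f cf fnd|].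
  apply: contrapT => /(steep_family_of_not_differentiable cf fnd hz)[H].
  move=> /steep_family_fun[g [_ gnd gd gz]].
  exact: steep_at_not_random gnd gd gz Zz Zr.
split=> [D g cg gnd|]; first by have [_] := D g cg gnd; rewrite fin_numElt => /andP[].
split=> [U g cg gnd|L].
  exact: le_lt_trans (lower_le_upper_derivative g hz) (U g cg gnd).
(* (iv) excludes every steep family at z, hence every computable martingale that succeeds on z. *)
have nsteep H : ~ steep_family H z.
  move=> /steep_family_fun[g [cg gnd _ gz]]; have := L g cg gnd.
  by rewrite (steep_at_lower_derivative zle gz) ltxx.
have [Z Zz] := binary_expansion_exists hz; exists Z => // M mM cM suc.
have [H /nsteep//] : exists H, steep_family H z.
apply: (steep_family_of_martingale mM cM Zz _ suc) => n j; apply/eqP => zE.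
(* A dyadic z would have a steep family from the step function, so (iv) also rules out this case. *)
have [H] : exists H, steep_family H z.
  by rewrite zE; apply: steep_family_dyadic; rewrite -zE.
exact: nsteep.
Qed.
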